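(* Let $\mathcal N\subset{\rm T}^{\mathbb C}\mathcal M$ be an integrable field of totally null 2-planes on a 4-dimensional manifold $(\mathcal M,g)$ equipped with a metric $g$. Let $\check\nabla$ be the characteristic connection of $\mathcal N$ and $\check R_{AB}$ its Ricci tensor. Assume that the tensor $\check\nabla_{[C}\check\nabla_{D]}\check R_{AB}$ vanishes everywhere on $\mathcal M$, $$\check\nabla_{[C}\check\nabla_{D]}\check R_{AB}\equiv 0 .$$ Then $(\mathcal M,g)$ is algebraically special at every point of $\mathcal M$, with a multiple field of principal totally null 2-planes tangent to $\mathcal N$ (that is, $\mathcal N$ is a field of multiple principal totally null 2-planes).
   Context: $g$ is a complex-valued metric (a nondegenerate symmetric complex bilinear form on ${\rm T}^{\mathbb C}\mathcal M$; real metrics of any signature are included). A field of totally null 2-planes is a complex rank-2 subbundle $\mathcal N\subset{\rm T}^{\mathbb C}\mathcal M$ with $g_{|\mathcal N}\equiv0$; integrable means $[\mathcal N,\mathcal N]\subset\mathcal N$. Characteristic connection: when $\mathcal N$ is integrable there exist (locally) torsionless complex connections $\nabla^W$ with $\nabla^Wg=-B\otimes g$ for some complex 1-form $B$ and $\nabla^W_YX\in\mathcal N$ for all $X\in\mathcal N$, $Y\in{\rm T}\mathcal M$; all of them restrict to one and the same partial connection $\check\nabla$ on $\mathcal N$, $\check\nabla_XY=\nabla^W_XY$ for $X,Y\in\mathcal N$, called the characteristic connection of $\mathcal N$; it is torsionless. Its curvature is $\check R(X,Y)Z=\check\nabla_X\check\nabla_YZ-\check\nabla_Y\check\nabla_XZ-\check\nabla_{[X,Y]}Z$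 for $X,Y,Z\in\mathcal N$; in a local frame $(f_1,f_2)$ of $\mathcal N$, $\check R(f_C,f_D)f_B=\check R^A{}_{BCD}f_A$, and $\check R_{AB}=\check R^C{}_{ACB}$, $A,B,C,D=1,2$. $\check\nabla$ is extended to tensors on $\mathcal N$ by the Leibniz rule, $\check\nabla_C\check\nabla_D\check R_{AB}$ denotes the components of the second covariant derivative of the tensor $\check R_{AB}$, and square brackets denote antisymmetrization. Algebraic speciality: a null frame adapted to $\mathcal N$ is a local frame $(m,p,n,k)$ with $g(m,p)=g(n,k)=1$, all other products of frame vectors zero, and $\mathcal N={\rm Span}_{\mathbb C}(m,k)$. With $C$ the Weyl tensor of $g$, $\mathcal N$ is a field of multiple principal totally null 2-planes iff $\Psi_0=C(m,k,m,k)\equiv0$ and $\Psi_1=C(m,k,n,k)\equiv0$ in adapted null frames. (Equivalently, $z=0$ is a multiple root of the quartic $z\mapsto C(m+zn,k-zp,m+zn,k-zp)$.) $(\mathcal M,g)$ is algebraically special at a point if a multiple principal totally null 2-plane exists there. *)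

(* Defs.v *)
From HB Require Import structures.
From mathcomp Require Import all_boot all_order all_algebra.
From mathcomp Require Import complex.
From mathcomp Require Import all_classical all_reals all_analysis.

Set Implicit Arguments.
Unset Strict Implicit.
Unset Printing Implicit Defensive.

Import Order.TTheory GRing.Theory Num.Theory.
Import numFieldNormedType.Exports.

Local Open Scope classical_set_scope.
Local Open Scope ring_scope.

Section EuclideanSmoothness.
Context {R : realType}.

Definition partial (i : 'I_4) (f : 'rV[R]_4 -> R) : 'rV[R]_4 -> R :=
  fun x => 'D_(delta_mx 0 i) f x.

(* C^oo on an open set: all iterated partial derivatives exist and are
   (Frechet) differentiable, hence continuous, at every point of the set. *)
Definition smooth_real (U : set 'rV[R]_4) (f : 'rV[R]_4 -> R) : Prop :=
  forall (s : seq 'I_4) (x : 'rV[R]_4), U x ->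
    differentiable (foldr partial f s) x.

Definition smooth_cplx (U : set 'rV[R]_4) (f : 'rV[R]_4 -> R[i]) : Prop :=
  smooth_real U (fun x => complex.Re (f x)) /\
  smooth_real U (fun x => complex.Im (f x)).

Definition partialC (i : 'I_4) (f : 'rV[R]_4 -> R[i]) : 'rV[R]_4 -> R[i] :=
  fun x => Complex (partial i (fun y => complex.Re (f y)) x)
                   (partial i (fun y => complex.Im (f y)) x).

End EuclideanSmoothness.

(* Only the restriction of [chart_map] to [chart_dom], and that of [chart_inv]
   to the image of [chart_dom], are meaningful. *)
Record chart (R : realType) (M : topologicalType) := Chart {
  chart_dom : set M;
  chart_map : M -> 'rV[R]_4;
  chart_inv : 'rV[R]_4 -> M }.

(* A complex tangent vector at a point p is represented by its action on
   functions M -> C; all the vectors used below are set to vanish on the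
   functions that are not smooth near p, so that equality of operators is
   equality of tangent vectors.  [R[i]^o] provides the C-linear structure. *)
Definition tvec (R : realType) (M : topologicalType) : Type :=
  (M -> R[i]) -> R[i]^o.
Definition vfield (R : realType) (M : topologicalType) : Type := M -> tvec R M.

Section Manifold.
Context {R : realType} {M : topologicalType}.
Local Notation C := (R[i]).
Local Notation tvec := (tvec R M).
Local Notation vfield := (vfield R M).

Definition is_chart (c : chart R M) : Prop :=
  [/\ open (chart_dom c),
      open (chart_map c @` chart_dom c),
      forall p, chart_dom c p -> chart_inv c (chart_map c p) = p,
      {within chart_dom c, continuous (chart_map c)} &
      {within chart_map c @` chart_dom c, continuous (chart_inv c)}].

Definition smooth_manifold (A : set (chart R M)) : Prop :=
  [/\ hausdorff_space M, @second_countable M,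
      forall c, A c -> is_chart c,
      forall p : M, exists2 c, A c & chart_dom c p &
      forall c d, A c -> A d -> forall i : 'I_4,
        smooth_real (chart_map c @` (chart_dom c `&` chart_dom d))
          (fun x => chart_map d (chart_inv c x) 0 i)].

Definition apply_field (X : vfield) (f : M -> C) : M -> C := fun p => X p f.

Definition lincomb n (v : 'I_n -> tvec) (a : 'rV[C]_n) : tvec :=
  \sum_(i < n) a 0 i *: v i.

Definition free_fam n (v : 'I_n -> tvec) : Prop :=
  forall a : 'rV[C]_n, lincomb v a = 0 -> a = 0.

Definition span_fam n (v : 'I_n -> tvec) : set tvec := range (lincomb v).

Section Atlas.
Variable A : set (chart R M).

Definition smooth_on (V : set M) (f : M -> C) : Prop :=
  forall c, A c ->
    smooth_cplx (chart_map c @` (V `&` chart_dom c)) (f \o chart_inv c).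

Definition smooth_near (p : M) (f : M -> C) : Prop :=
  exists V : set M, [/\ open V, V p & smooth_on V f].

Definition coord_vec (c : chart R M) (p : M) (i : 'I_4) : tvec := fun f =>
  if `[< smooth_near p f >] then partialC i (f \o chart_inv c) (chart_map c p)
  else 0.

(* The complexified tangent space at p, spanned by the coordinate vectors of
   any chart around p. *)
Definition tangent (p : M) : set tvec := [set v |
  exists c, [/\ A c, chart_dom c p & span_fam (coord_vec c p) v]].

Definition vfield_on (V : set M) (X : vfield) : Prop :=
  (forall p, V p -> tangent p (X p)) /\
  (forall (W : set M) f, open W -> W `<=` V ->
     smooth_on W f -> smooth_on W (apply_field X f)).

Definition lie (X Y : vfield) : vfield := fun p f =>
  if `[< smooth_near p f >]
  then X p (apply_field Y f) - Y p (apply_field X f) else 0.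

(* (e_i) is a smooth local frame over V of the bundle with fibres E p. *)
Definition local_frame n (E : M -> set tvec) (V : set M)
    (e : 'I_n -> vfield) : Prop :=
  (forall i, vfield_on V (e i)) /\
  (forall p, V p -> free_fam (e ^~ p) /\ E p = span_fam (e ^~ p)).

Definition subbundle n (E : M -> set tvec) : Prop :=
  forall p : M, exists V : set M, [/\ open V, V p &
    exists e : 'I_n -> vfield, local_frame E V e].

Definition section_on (E : M -> set tvec) (V : set M) (X : vfield) : Prop :=
  vfield_on V X /\ forall p, V p -> E p (X p).

Definition integrable_field (N : M -> set tvec) : Prop :=
  forall (V : set M) (X Y : vfield), open V ->
    section_on N V X -> section_on N V Y -> section_on N V (lie X Y).

(* A symmetric nondegenerate complex bilinear form on the complexified tangent
   bundle, depending smoothly on the point. *)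
Definition complex_metric (g : M -> tvec -> tvec -> C) : Prop :=
  [/\ forall p (a : C) u v w, tangent p u -> tangent p v -> tangent p w ->
        g p (a *: u + v) w = a * g p u w + g p v w,
      forall p u v, tangent p u -> tangent p v -> g p u v = g p v u,
      forall p u, tangent p u -> (forall v, tangent p v -> g p u v = 0) ->
        u = 0 &
      forall (V : set M) X Y, open V -> vfield_on V X -> vfield_on V Y ->
        smooth_on V (fun p => g p (X p) (Y p))].

Definition complex_form (U : set M) (B : M -> tvec -> C) : Prop :=
  (forall p (a : C) u v, U p -> tangent p u -> tangent p v ->
     B p (a *: u + v) = a * B p u + B p v) /\
  (forall (V : set M) X, open V -> V `<=` U -> vfield_on V X ->
     smooth_on V (fun p => B p (X p))).

(* A complex linear connection on the tangent bundle over the open set U, as a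
   morphism of sheaves: [D X Y] stands for D_X Y, and it is constrained over
   an open subset V of U only for X and Y smooth on V. *)
Definition connection (U : set M) (D : vfield -> vfield -> vfield) : Prop :=
  forall V : set M, open V -> V `<=` U ->
  [/\ forall X Y, vfield_on V X -> vfield_on V Y -> vfield_on V (D X Y),
      forall X X' Y Y', vfield_on V X -> vfield_on V X' ->
        vfield_on V Y -> vfield_on V Y' ->
        (forall p, V p -> X p = X' p) -> (forall p, V p -> Y p = Y' p) ->
        forall p, V p -> D X Y p = D X' Y' p,
      forall f X X' Y, smooth_on V f ->
        vfield_on V X -> vfield_on V X' -> vfield_on V Y ->
        forall p, V p ->
          D (fun q => f q *: X q + X' q) Y p = f p *: D X Y p + D X' Y p,
      forall X Y Y', vfield_on V X -> vfield_on V Y -> vfield_on V Y' ->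
        forall p, V p -> D X (fun q => Y q + Y' q) p = D X Y p + D X Y' p &
      forall f X Y, smooth_on V f -> vfield_on V X -> vfield_on V Y ->
        forall p, V p ->
          D X (fun q => f q *: Y q) p = X p f *: Y p + f p *: D X Y p].

Definition torsion_free (U : set M) (D : vfield -> vfield -> vfield) : Prop :=
  forall (V : set M) X Y, open V -> V `<=` U ->
    vfield_on V X -> vfield_on V Y ->
    forall p, V p -> D X Y p - D Y X p = lie X Y p.

(* The value (D_X g)(Y, Z). *)
Definition nabla_metric (g : M -> tvec -> tvec -> C)
    (D : vfield -> vfield -> vfield) (X Y Z : vfield) : M -> C := fun p =>
  X p (fun q => g q (Y q) (Z q)) - g p (D X Y p) (Z p) - g p (Y p) (D X Z p).

Definition levi_civita (g : M -> tvec -> tvec -> C)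
    (D : vfield -> vfield -> vfield) : Prop :=
  [/\ connection setT D, torsion_free setT D &
      forall (V : set M) X Y Z, open V ->
        vfield_on V X -> vfield_on V Y -> vfield_on V Z ->
        forall p, V p -> nabla_metric g D X Y Z p = 0].

Definition curvature (D : vfield -> vfield -> vfield) (X Y Z : vfield) :
    vfield := fun p =>
  D X (D Y Z) p - D Y (D X Z) p - D (lie X Y) Z p.

(* The i-th component of X in the frame e. *)
Definition component n (e : 'I_n -> vfield) (X : vfield) (i : 'I_n) : M -> C :=
  fun p => xget 0 [set a : 'rV[C]_n | X p = lincomb (e ^~ p) a] 0 i.

Definition totally_null_plane (g : M -> tvec -> tvec -> C) (p : M)
    (P : set tvec) : Prop :=
  (exists v : 'I_2 -> tvec,
     [/\ forall i, tangent p (v i), free_fam v & P = span_fam v]) /\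
  (forall u w, P u -> P w -> g p u w = 0).

Definition totally_null_field (g : M -> tvec -> tvec -> C)
    (N : M -> set tvec) : Prop :=
  subbundle 2 N /\ forall p, totally_null_plane g p (N p).

Definition adapted_weyl_connection (g : M -> tvec -> tvec -> C)
    (N : M -> set tvec) (U : set M) (W : vfield -> vfield -> vfield) : Prop :=
  [/\ connection U W, torsion_free U W,
      exists B, complex_form U B /\
        forall (V : set M) X Y Z, open V -> V `<=` U ->
          vfield_on V X -> vfield_on V Y -> vfield_on V Z ->
          forall p, V p ->
            nabla_metric g W X Y Z p = - (B p (X p) * g p (Y p) (Z p)) &
      forall (V : set M) Y X, open V -> V `<=` U ->
        vfield_on V Y -> section_on N V X -> section_on N V (W Y X)].

(* D is a partial connection on N: only its values [D X Y] for X and Y sections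
   of N over some open set are constrained. *)
Definition characteristic_connection (g : M -> tvec -> tvec -> C)
    (N : M -> set tvec) (D : vfield -> vfield -> vfield) : Prop :=
  forall p : M, exists U W,
    [/\ open U, U p, adapted_weyl_connection g N U W &
        forall (V : set M) X Y, open V -> V `<=` U ->
          section_on N V X -> section_on N V Y ->
          forall q, V q -> D X Y q = W X Y q].

(* The Ricci tensor of a partial connection D on the bundle framed by f:
   Ric(Y, Z) is the trace of X |-> R(X, Z) Y, so that
   Ric(f_A, f_B) = R^C_{ACB} where R(f_C, f_D) f_B = R^A_{BCD} f_A. *)
Definition ricci_partial n (D : vfield -> vfield -> vfield)
    (f : 'I_n -> vfield) (Y Z : vfield) : M -> C := fun p =>
  \sum_(i < n) component f (curvature D (f i) Z Y) i p.

(* The value (D_X T)(Y, Z). *)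
Definition cov1 (D : vfield -> vfield -> vfield)
    (T : vfield -> vfield -> M -> C) (X Y Z : vfield) : M -> C := fun p =>
  X p (T Y Z) - T (D X Y) Z p - T Y (D X Z) p.

(* The value (D D T)(W, X; Y, Z); on frame vectors W = f_C, X = f_D, Y = f_A,
   Z = f_B this is the component D_C D_D T_{AB}. *)
Definition cov2 (D : vfield -> vfield -> vfield)
    (T : vfield -> vfield -> M -> C) (W X Y Z : vfield) : M -> C := fun p =>
  W p (cov1 D T X Y Z) - cov1 D T (D W X) Y Z p
  - cov1 D T X (D W Y) Z p - cov1 D T X Y (D W Z) p.

Definition antisym_cov2_ricci_vanishes (N : M -> set tvec)
    (D : vfield -> vfield -> vfield) : Prop :=
  forall (V : set M) (f : 'I_2 -> vfield), open V -> local_frame N V f ->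
  forall (c d a b : 'I_2) p, V p ->
    (cov2 D (ricci_partial D f) (f c) (f d) (f a) (f b) p
     - cov2 D (ricci_partial D f) (f d) (f c) (f a) (f b) p) / 2%:R = 0.

Section Weyl.
Variables (g : M -> tvec -> tvec -> C) (nabla : vfield -> vfield -> vfield).

Definition gram (e : 'I_4 -> vfield) (p : M) : 'M[C]_4 :=
  \matrix_(a, b) g p (e a p) (e b p).

Definition riemann (e : 'I_4 -> vfield) (a b c d : 'I_4) : M -> C := fun p =>
  g p (e a p) (curvature nabla (e c) (e d) (e b) p).

Definition ricci (e : 'I_4 -> vfield) (b d : 'I_4) : M -> C := fun p =>
  \sum_a \sum_c invmx (gram e p) a c * riemann e a b c d p.

Definition scalar_curvature (e : 'I_4 -> vfield) : M -> C := fun p =>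
  \sum_b \sum_d invmx (gram e p) b d * ricci e b d p.

(* C_{abcd} in the frame e, with the coefficients 1/(n-2) and 1/((n-1)(n-2))
   for n = 4. *)
Definition weyl (e : 'I_4 -> vfield) (a b c d : 'I_4) : M -> C := fun p =>
  let G := gram e p in
  riemann e a b c d p
  - (G a c * ricci e b d p - G a d * ricci e b c p
     - G b c * ricci e a d p + G b d * ricci e a c p) / 2%:R
  + scalar_curvature e p * (G a c * G b d - G a d * G b c) / 6%:R.

Definition frame4 (m p n k : vfield) : 'I_4 -> vfield := tnth [tuple m; p; n; k].

(* Gram matrix of a null frame (m, p, n, k): entry 1 exactly at the positions
   of the pairs {m, p} and {n, k}. *)
Definition null_gram : 'M[C]_4 :=
  \matrix_(a, b) ((a./2 == b./2) && (a != b))%:R.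

Definition null_frame (V : set M) (m p n k : vfield) : Prop :=
  local_frame tangent V (frame4 m p n k) /\
  forall q, V q -> gram (frame4 m p n k) q = null_gram.

Definition idx_m : 'I_4 := inord 0.
Definition idx_n : 'I_4 := inord 2.
Definition idx_k : 'I_4 := inord 3.

Definition Psi0 (m p n k : vfield) : M -> C :=
  weyl (frame4 m p n k) idx_m idx_k idx_m idx_k.
Definition Psi1 (m p n k : vfield) : M -> C :=
  weyl (frame4 m p n k) idx_m idx_k idx_n idx_k.

(* P is a multiple principal totally null 2-plane at q: Psi0 and Psi1 vanish at
   q in the null frames defined near q and adapted to P at q. *)
Definition multiple_principal_plane (q : M) (P : set tvec) : Prop :=
  totally_null_plane g q P /\
  forall (V : set M) (m p n k : vfield), open V -> V q ->
    null_frame V m p n k ->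
    P = span_fam (tnth [tuple m q; k q]) ->
    Psi0 m p n k q = 0 /\ Psi1 m p n k q = 0.

Definition algebraically_special (q : M) : Prop :=
  exists P : set tvec, multiple_principal_plane q P.

Definition multiple_principal_field (N : M -> set tvec) : Prop :=
  forall q : M, multiple_principal_plane q (N q).

End Weyl.
End Atlas.
End Manifold.

(* Main.v *)
(* The Ricci identity of the characteristic connection D turns the hypothesis
   into Ric(S f_A, f_B) + Ric(f_A, S f_B) = 0 with S = R(f_1, f_2).  In rank 2
   the curvature S is determined by Ric, and these equations force
   (Ric_12 - Ric_21)^2 = 0, that is, tr S = 0.
   Let D be induced by a Weyl connection W with W g = - 2 b (x) g preserving N.
   By the Bianchi identity R^W(f_1, f_2) h is orthogonal to N for every h, and
   metricity of W up to scale gives tr S = 4 db(f_1, f_2); hence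
   db(f_1, f_2) = 0.  On N the Levi-Civita connection differs from W by
   b(X) Y + b(Y) X, so it preserves N along N, which gives Psi_0 = 0, and its
   curvature trace on N is tr S - 3 db(f_1, f_2) = 0.  By pair symmetry of the
   Riemann tensor this trace is 2 Psi_1. *)
Require Import Defs.
From HB Require Import structures.
From mathcomp Require Import all_boot all_order all_algebra.
From mathcomp Require Import complex ring.
From mathcomp Require Import all_classical all_reals all_analysis.

Set Implicit Arguments.
Unset Strict Implicit.
Unset Printing Implicit Defensive.

Import Order.TTheory GRing.Theory Num.Theory.
Import numFieldNormedType.Exports.

Local Open Scope classical_set_scope.
Local Open Scope ring_scope.

(** The rank 2 step rests on an area form. Let omega be the 2-form on N with omega(f_1, f_2) = 1.
    Then R(X, Z) = omega(X, Z) S, so the trace defining the Ricci tensor is Ric(Y, Z) = omega(S Y,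
    Z), and since omega(S Y, S Z) = det S omega(Y, Z) the hypothesis says S^2 + det S = 0. Compared
    with Cayley-Hamilton, S^2 - (tr S) S + det S = 0, this gives (tr S) S = 0, whose trace is (tr
    S)^2 = 0. Two obstacles shape the rest. A null frame (m, p, n, k) is adapted to N at the point q
    only, whereas the characteristic connection differentiates nothing but sections of N; hence a
    frame of N dual to (p, n), equal to (m, k) at q, to which curvatures are transported by
    tensoriality. Moreover [tangent] is a union of spans over all charts, whose closure under linear
    combinations would require the chain rule for chart changes; it is carried as the hypothesis
    [tangent_lin] and obtained from the null frame, whose span is the tangent space. *)

Lemma near_eq_differentiable (K : numFieldType) (V W : normedModType K)
    (f g : V -> W) (x : V) :
  (\forall y \near x, f y = g y) -> differentiable f x -> differentiable g x.
Proof.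
move=> fg /diff_locallyP[df_cont df_eq].
have gx : g x = f x by rewrite (nbhs_singleton fg).
have fg0 : \forall h \near (0 : V), f (h + x) = g (h + x).
  by move: fg; rewrite (near_shift 0) subr0.
have g_eq : g \o shift x = cst (g x) + 'd f x +o_ 0 id.
  apply/eqaddoP => _/posnumP[e].
  move/eqaddoP: df_eq => /(_ e%:num (gt0 e)) df_eq.
  near=> h.
  have -> : (g \o shift x - (cst (g x) + 'd f x)) h
            = (f \o shift x - (cst (f x) + 'd f x)) h.
    by rewrite !fctE /= gx; congr (_ - _); apply/esym; near: h; exact: fg0.
  by near: h.
have dg : 'd g x = 'd f x :> (V -> W) by exact: diff_unique.
by apply/diff_locallyP; rewrite dg.
Unshelve. all: by end_near. Qed.

(** * Smooth functions *)

Section SmoothReal.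
Context {R : realType}.
Implicit Types (U : set 'rV[R]_4) (f g : 'rV[R]_4 -> R) (n : nat).

Lemma open_near U (P : 'rV[R]_4 -> Prop) x : open U -> U x ->
  (forall y, U y -> P y) -> \forall y \near x, P y.
Proof. by move=> oU Ux UP; apply: filterS UP _; apply: open_nbhs_nbhs. Qed.

Lemma partial_ext U f g i x : open U -> (forall y, U y -> f y = g y) -> U x ->
  partial i f x = partial i g x.
Proof. by move=> oU fg Ux; apply: near_eq_derive; apply: open_near fg. Qed.

Lemma partialD f g i x : differentiable f x -> differentiable g x ->
  partial i (fun y => f y + g y) x = partial i f x + partial i g x.
Proof. by move=> df dg; apply: deriveD; apply: diff_derivable. Qed.

Lemma partialM f g i x : differentiable f x -> differentiable g x ->
  partial i (fun y => f y * g y) x = partial i f x * g x + f x * partial i g x.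
Proof.
move=> df dg; rewrite /partial.
have -> : (fun y => f y * g y) = f * g by [].
rewrite deriveM; [|exact: diff_derivable|exact: diff_derivable].
by rewrite addrC [g x *: _]mulrC.
Qed.

Lemma partialV f i x : differentiable f x -> f x != 0 ->
  partial i (fun y => (f y)^-1) x = - partial i f x * (f x)^-1 * (f x)^-1.
Proof.
move=> df fx0; rewrite /partial deriveV //; last exact: diff_derivable.
by rewrite /GRing.scale /= -exprVn expr2 mulNr mulrC mulrA !mulNr.
Qed.

Lemma partial_cst (a : R) i x : partial i (fun=> a) x = 0.
Proof. exact: derive_cst. Qed.

(** Truncation at order n makes induction possible: the derivative of a product involves both
    factors and their derivatives, each needed only to order n. *)
Definition smooth_upto U n f := forall (s : seq 'I_4) (x : 'rV[R]_4),
  (size s <= n)%N -> U x -> differentiable (foldr (@partial R) f s) x.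

Lemma smooth_uptoP U f : smooth_real U f <-> forall n, smooth_upto U n f.
Proof.
split=> [sf n s x _|sf s x Ux]; first exact: sf.
exact: (sf (size s)).
Qed.

(** [foldr] applies the last index of the list first, so the innermost derivative is peeled off with
    [rcons]. This is the recursion on which the closure lemmas rest. *)
Lemma smooth_uptoS U n f : smooth_upto U n.+1 f <->
  (forall x, U x -> differentiable f x) /\
  (forall i, smooth_upto U n (partial i f)).
Proof.
split=> [sf|[df sf] s x].
  split=> [x Ux|i s x sn Ux]; first exact: (sf [::]).
  by move: (sf (rcons s i) x); rewrite size_rcons foldr_rcons; apply.
case/lastP: s => [|s i] sn Ux; first exact: df.
by rewrite foldr_rcons; apply: sf => //; rewrite size_rcons in sn.
Qed.

Lemma smooth_upto0 U f :
  (forall x, U x -> differentiable f x) -> smooth_upto U 0 f.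
Proof. by move=> df [|//] x _; exact: df. Qed.

Lemma smooth_uptoW U n f : smooth_upto U n.+1 f -> smooth_upto U n f.
Proof. by move=> sf s x sn; apply: sf; rewrite (leq_trans sn). Qed.

Lemma smooth_upto_diff U n f x : smooth_upto U n f -> U x -> differentiable f x.
Proof. by move=> sf; exact: (sf [::]). Qed.

Lemma foldr_partial_ext U f g s : open U -> (forall y, U y -> f y = g y) ->
  forall y, U y -> foldr (@partial R) f s y = foldr (@partial R) g s y.
Proof.
move=> oU fg; elim: s => [//|i s IHs] y Uy /=.
exact: (partial_ext i oU IHs Uy).
Qed.

Lemma smooth_upto_ext U n f g : open U -> (forall y, U y -> f y = g y) ->
  smooth_upto U n f -> smooth_upto U n g.
Proof.
move=> oU fg sf s x sn Ux; apply: near_eq_differentiable (sf s x sn Ux).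
exact: (open_near oU Ux (foldr_partial_ext s oU fg)).
Qed.

Lemma smooth_upto_cst U n (a : R) : open U -> smooth_upto U n (fun=> a).
Proof.
move=> oU; elim: n a => [|n IHn] a.
  by apply: smooth_upto0 => x _; exact: differentiable_cst.
apply/smooth_uptoS; split=> [x _|i]; first exact: differentiable_cst.
by apply: smooth_upto_ext (IHn 0) => // x Ux; rewrite partial_cst.
Qed.

Lemma smooth_uptoD U n f g : open U -> smooth_upto U n f -> smooth_upto U n g ->
  smooth_upto U n (fun x => f x + g x).
Proof.
move=> oU; elim: n f g => [|n IHn] f g sf sg.
  apply: smooth_upto0 => x Ux; apply: differentiableD.
    exact: smooth_upto_diff sf Ux.
  exact: smooth_upto_diff sg Ux.
have [df sf'] := (smooth_uptoS _ _ _).1 sf.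
have [dg sg'] := (smooth_uptoS _ _ _).1 sg.
apply/smooth_uptoS; split=> [x Ux|i].
  by apply: differentiableD; [exact: df|exact: dg].
apply: smooth_upto_ext (IHn _ _ (sf' i) (sg' i)) => // x Ux.
by rewrite partialD //; [exact: df|exact: dg].
Qed.

Lemma smooth_uptoM U n f g : open U -> smooth_upto U n f -> smooth_upto U n g ->
  smooth_upto U n (fun x => f x * g x).
Proof.
move=> oU; elim: n f g => [|n IHn] f g sf sg.
  apply: smooth_upto0 => x Ux; apply: differentiableM.
    exact: smooth_upto_diff sf Ux.
  exact: smooth_upto_diff sg Ux.
have [df sf'] := (smooth_uptoS _ _ _).1 sf.
have [dg sg'] := (smooth_uptoS _ _ _).1 sg.
apply/smooth_uptoS; split=> [x Ux|i].
  by apply: differentiableM; [exact: df|exact: dg].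
apply: smooth_upto_ext (smooth_uptoD oU (IHn _ _ (sf' i) (smooth_uptoW sg))
  (IHn _ _ (smooth_uptoW sf) (sg' i))) => // x Ux.
by rewrite partialM //; [exact: df|exact: dg].
Qed.

(** Induction on the order: the derivative of 1/f is - f' / f^2, a product of functions already
    known to be smooth to order n. *)
Lemma smooth_uptoV U n f : open U -> (forall x, U x -> f x != 0) ->
  smooth_upto U n f -> smooth_upto U n (fun x => (f x)^-1).
Proof.
move=> oU f0; elim: n => [|n IHn] sf.
  apply: smooth_upto0 => x Ux; apply: differentiableV (f0 _ Ux).
  exact: smooth_upto_diff sf Ux.
have [df sf'] := (smooth_uptoS _ _ _).1 sf.
apply/smooth_uptoS; split=> [x Ux|i].
  by apply: differentiableV (f0 _ Ux); exact: df.
have sV := IHn (smooth_uptoW sf).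
have sN := smooth_uptoM oU (@smooth_upto_cst U n (-1) oU) (sf' i).
apply: smooth_upto_ext (smooth_uptoM oU (smooth_uptoM oU sN sV) sV) => // x Ux.
by rewrite partialV ?mulN1r //; [exact: df|exact: f0].
Qed.

Lemma smooth_real_ext U f g : open U -> (forall y, U y -> f y = g y) ->
  smooth_real U f -> smooth_real U g.
Proof.
move=> oU fg /smooth_uptoP sf; apply/smooth_uptoP => n.
exact: smooth_upto_ext (sf n).
Qed.

Lemma smooth_real_cst U (a : R) : open U -> smooth_real U (fun=> a).
Proof. by move=> oU; apply/smooth_uptoP => n; exact: smooth_upto_cst. Qed.

Lemma smooth_realD U f g : open U -> smooth_real U f -> smooth_real U g ->
  smooth_real U (fun x => f x + g x).
Proof.
move=> oU /smooth_uptoP sf /smooth_uptoP sg; apply/smooth_uptoP => n.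
exact: smooth_uptoD.
Qed.

Lemma smooth_realM U f g : open U -> smooth_real U f -> smooth_real U g ->
  smooth_real U (fun x => f x * g x).
Proof.
move=> oU /smooth_uptoP sf /smooth_uptoP sg; apply/smooth_uptoP => n.
exact: smooth_uptoM.
Qed.

Lemma smooth_realV U f : open U -> (forall x, U x -> f x != 0) ->
  smooth_real U f -> smooth_real U (fun x => (f x)^-1).
Proof.
move=> oU f0 /smooth_uptoP sf; apply/smooth_uptoP => n.
exact: smooth_uptoV.
Qed.

Lemma smooth_realB U f g : open U -> smooth_real U f -> smooth_real U g ->
  smooth_real U (fun x => f x - g x).
Proof.
move=> oU sf sg; apply: (smooth_real_ext oU (f := fun x => f x + -1 * g x)).
  by move=> x _; rewrite mulN1r.
exact: smooth_realD oU sf (smooth_realM oU (smooth_real_cst _ oU) sg).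
Qed.

Lemma smooth_realS U V f : V `<=` U -> smooth_real U f -> smooth_real V f.
Proof. by move=> VU sf s x /VU; exact: sf. Qed.

Lemma smooth_real_diff U f x : smooth_real U f -> U x -> differentiable f x.
Proof. by move=> sf; exact: (sf [::]). Qed.

End SmoothReal.

(** * Complex-valued smooth functions on open sets of R^4 *)

Section SmoothCplx.
Context {R : realType}.
Implicit Types (U : set 'rV[R]_4) (f g : 'rV[R]_4 -> R[i]).

Lemma ReD (x y : R[i]) : complex.Re (x + y) = complex.Re x + complex.Re y.
Proof. by case: x y => [a b] [c d]. Qed.

Lemma ImD (x y : R[i]) : complex.Im (x + y) = complex.Im x + complex.Im y.
Proof. by case: x y => [a b] [c d]. Qed.

Lemma ReM (x y : R[i]) : complex.Re (x * y) =
  complex.Re x * complex.Re y - complex.Im x * complex.Im y.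
Proof. by case: x y => [a b] [c d]. Qed.

Lemma ImM (x y : R[i]) : complex.Im (x * y) =
  complex.Re x * complex.Im y + complex.Im x * complex.Re y.
Proof. by case: x y => [a b] [c d]. Qed.

(** Kept as a polynomial in the real and imaginary parts, so that smoothness follows from sums and
    products; it is the denominator of both parts of 1/x. *)
Definition sqr_modulus (x : R[i]) : R := complex.Re x * complex.Re x + complex.Im x * complex.Im x.

Lemma sqr_modulus_eq0 (x : R[i]) : (sqr_modulus x == 0) = (x == 0).
Proof.
case: x => a b; rewrite /sqr_modulus eq_complex /= -!expr2.
by rewrite paddr_eq0 ?sqr_ge0 // !sqrf_eq0.
Qed.

Lemma ReV (x : R[i]) : complex.Re x^-1 = complex.Re x * (sqr_modulus x)^-1.
Proof. by case: x => a b; rewrite /sqr_modulus -!expr2. Qed.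

Lemma ImV (x : R[i]) : complex.Im x^-1 = -1 * complex.Im x * (sqr_modulus x)^-1.
Proof. by case: x => a b; rewrite /sqr_modulus -!expr2 mulN1r mulNr. Qed.

Lemma smooth_cplx_ext U f g : open U -> (forall y, U y -> f y = g y) ->
  smooth_cplx U f -> smooth_cplx U g.
Proof.
move=> oU fg [sr si]; split.
  by apply: smooth_real_ext sr => // y Uy; rewrite fg.
by apply: smooth_real_ext si => // y Uy; rewrite fg.
Qed.

Lemma smooth_cplxS U V f : V `<=` U -> smooth_cplx U f -> smooth_cplx V f.
Proof. by move=> VU [sr si]; split; [exact: smooth_realS sr|exact: smooth_realS si]. Qed.

Lemma smooth_cplx_cst U (a : R[i]) : open U -> smooth_cplx U (fun=> a).
Proof. by move=> oU; split; exact: smooth_real_cst. Qed.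

Lemma smooth_cplxD U f g : open U -> smooth_cplx U f -> smooth_cplx U g ->
  smooth_cplx U (fun x => f x + g x).
Proof.
move=> oU [fr fi] [gr gi]; split.
  by apply: smooth_real_ext (smooth_realD oU fr gr) => // y _; rewrite ReD.
by apply: smooth_real_ext (smooth_realD oU fi gi) => // y _; rewrite ImD.
Qed.

Lemma smooth_cplxM U f g : open U -> smooth_cplx U f -> smooth_cplx U g ->
  smooth_cplx U (fun x => f x * g x).
Proof.
move=> oU [fr fi] [gr gi]; split.
  apply: smooth_real_ext (smooth_realB oU (smooth_realM oU fr gr)
    (smooth_realM oU fi gi)) => // y _; by rewrite ReM.
apply: smooth_real_ext (smooth_realD oU (smooth_realM oU fr gi)
  (smooth_realM oU fi gr)) => // y _; by rewrite ImM.
Qed.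

Lemma smooth_cplxV U f : open U -> (forall x, U x -> f x != 0) ->
  smooth_cplx U f -> smooth_cplx U (fun x => (f x)^-1).
Proof.
move=> oU f0 [fr fi].
have sm : smooth_real U (fun x => (sqr_modulus (f x))^-1).
  apply: smooth_realV => // [x Ux|]; first by rewrite sqr_modulus_eq0 f0.
  exact: smooth_realD oU (smooth_realM oU fr fr) (smooth_realM oU fi fi).
split.
  by apply: smooth_real_ext (smooth_realM oU fr sm) => // y _; rewrite ReV.
apply: smooth_real_ext (smooth_realM oU (smooth_realM oU
  (smooth_real_cst (-1) oU) fi) sm) => // y _; by rewrite ImV.
Qed.

Lemma partialC_ext U f g i x : open U -> (forall y, U y -> f y = g y) -> U x ->
  partialC i f x = partialC i g x.
Proof.
move=> oU fg Ux; rewrite /partialC; congr Complex.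
  by apply: partial_ext Ux => // y Uy; rewrite fg.
by apply: partial_ext Ux => // y Uy; rewrite fg.
Qed.

Lemma partialC_cst (a : R[i]) i x : partialC i (fun=> a) x = 0.
Proof. by rewrite /partialC !partial_cst. Qed.

Lemma partialCD U f g i x : smooth_cplx U f -> smooth_cplx U g -> U x ->
  partialC i (fun y => f y + g y) x = partialC i f x + partialC i g x.
Proof.
move=> [fr fi] [gr gi] Ux; rewrite /partialC.
have -> : (fun y => complex.Re (f y + g y)) =
  (fun y => complex.Re (f y) + complex.Re (g y)).
  by apply/funext => y; rewrite ReD.
have -> : (fun y => complex.Im (f y + g y)) =
  (fun y => complex.Im (f y) + complex.Im (g y)).
  by apply/funext => y; rewrite ImD.
by rewrite !partialD; do ?[exact: smooth_real_diff Ux].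
Qed.

Lemma partialCM U f g i x : smooth_cplx U f -> smooth_cplx U g -> U x ->
  partialC i (fun y => f y * g y) x = partialC i f x * g x + f x * partialC i g x.
Proof.
move=> [fr fi] [gr gi] Ux; rewrite /partialC.
have [dfr dfi] := (smooth_real_diff fr Ux, smooth_real_diff fi Ux).
have [dgr dgi] := (smooth_real_diff gr Ux, smooth_real_diff gi Ux).
have -> : (fun y => complex.Re (f y * g y)) =
  (fun y => complex.Re (f y) * complex.Re (g y)
            + -1 * (complex.Im (f y) * complex.Im (g y))).
  by apply/funext => y; rewrite ReM mulN1r.
have -> : (fun y => complex.Im (f y * g y)) =
  (fun y => complex.Re (f y) * complex.Im (g y)
            + complex.Im (f y) * complex.Re (g y)).
  by apply/funext => y; rewrite ImM.
have dM (u v : 'rV[R]_4 -> R) : differentiable u x -> differentiable v x ->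
  differentiable (fun y => u y * v y) x by exact: differentiableM.
have dc : differentiable (fun=> -1 : R) x by exact: differentiable_cst.
rewrite (partialD _ (dM _ _ dfr dgr) (dM _ _ dc (dM _ _ dfi dgi))).
rewrite (partialD _ (dM _ _ dfr dgi) (dM _ _ dfi dgr)).
rewrite (partialM _ dc (dM _ _ dfi dgi)) partial_cst mul0r add0r.
rewrite (partialM _ dfr dgr) (partialM _ dfi dgi) (partialM _ dfr dgi).
rewrite (partialM _ dfi dgr).
case: (f x) (g x) => [a b] [c d] /=.
by apply/eqP; rewrite eq_complex /=; apply/andP; split; apply/eqP; ring.
Qed.

End SmoothCplx.

(** * Smooth functions on the manifold, tangent vectors as derivations *)

Section SmoothFunctions.
Context {R : realType} {M : topologicalType} (A : set (chart R M)).
Hypothesis hM : smooth_manifold A.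
Implicit Types (U V : set M) (f g : M -> R[i]) (p : M) (v : tvec R M).

(** Within the open image of the chart, this set is the preimage of V under the continuous map
    [chart_inv c]. *)
Lemma open_chart_image V c : open V -> A c ->
  open (chart_map c @` (V `&` chart_dom c)).
Proof.
move=> oV Ac; have [_ _ /(_ c Ac)[odom oim chart_mapK _ inv_cont] _ _] := hM.
rewrite openE => _ [p [Vp dp] <-].
have imp : (chart_map c @` chart_dom c) (chart_map c p) by exists p.
rewrite continuous_open_subspace // in inv_cont.
have invV : \forall x \near chart_map c p, V (chart_inv c x).
  have := inv_cont _ (mem_set imp) V; rewrite chart_mapK //; apply.
  exact: open_nbhs_nbhs (conj oV Vp).
have nim : \forall x \near chart_map c p, (chart_map c @` chart_dom c) x.
  exact: open_nbhs_nbhs (conj oim imp).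
rewrite /interior /=; near=> x.
have [p' dp' xE] : (chart_map c @` chart_dom c) x by near: x.
have : V (chart_inv c x) by near: x.
rewrite -xE chart_mapK // => Vp'; by exists p'.
Unshelve. all: by end_near. Qed.

Lemma chart_mapK c p : A c -> chart_dom c p -> chart_inv c (chart_map c p) = p.
Proof. by move=> Ac; have [_ _ /(_ c Ac)[_ _ chart_mapK _ _] _ _] := hM; exact: chart_mapK. Qed.

Lemma smooth_on_ext V f g : open V -> (forall p, V p -> f p = g p) ->
  smooth_on A V f -> smooth_on A V g.
Proof.
move=> oV fg sf c Ac; apply: smooth_cplx_ext (sf c Ac).
  exact: open_chart_image.
by move=> _ [p [Vp dp] <-]; rewrite /= chart_mapK // fg.
Qed.

Lemma smooth_onS U V f : V `<=` U -> smooth_on A U f -> smooth_on A V f.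
Proof.
move=> VU sf c Ac; apply: smooth_cplxS (sf c Ac) => _ [p [Vp dp] <-].
by exists p; split => //; exact: VU.
Qed.

Lemma smooth_on_cst V (a : R[i]) : open V -> smooth_on A V (fun=> a).
Proof. by move=> oV c Ac; apply: smooth_cplx_cst; exact: open_chart_image. Qed.

Lemma smooth_onD V f g : open V -> smooth_on A V f -> smooth_on A V g ->
  smooth_on A V (fun p => f p + g p).
Proof.
move=> oV sf sg c Ac.
exact: smooth_cplxD (open_chart_image oV Ac) (sf c Ac) (sg c Ac).
Qed.

Lemma smooth_onM V f g : open V -> smooth_on A V f -> smooth_on A V g ->
  smooth_on A V (fun p => f p * g p).
Proof.
move=> oV sf sg c Ac.
exact: smooth_cplxM (open_chart_image oV Ac) (sf c Ac) (sg c Ac).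
Qed.

Lemma smooth_onV V f : open V -> (forall p, V p -> f p != 0) ->
  smooth_on A V f -> smooth_on A V (fun p => (f p)^-1).
Proof.
move=> oV f0 sf c Ac.
apply: smooth_cplxV (open_chart_image oV Ac) _ (sf c Ac).
by move=> _ [p [Vp dp] <-]; rewrite /= chart_mapK // f0.
Qed.

Lemma smooth_onN V f : open V -> smooth_on A V f ->
  smooth_on A V (fun p => - f p).
Proof.
move=> oV sf; apply: (smooth_on_ext oV (f := fun p => -1 * f p)).
  by move=> p _; rewrite mulN1r.
exact: smooth_onM oV (smooth_on_cst _ oV) sf.
Qed.

Lemma smooth_onB V f g : open V -> smooth_on A V f -> smooth_on A V g ->
  smooth_on A V (fun p => f p - g p).
Proof. by move=> oV sf sg; exact: smooth_onD oV sf (smooth_onN oV sg). Qed.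

Lemma smooth_on_near V f p : open V -> V p -> smooth_on A V f ->
  smooth_near A p f.
Proof. by move=> oV Vp sf; exists V. Qed.

(** In a chart the squared modulus of f is differentiable, hence continuous, so it stays nonzero
    near the image of p; continuity of [chart_map] pulls this back to M. *)
Lemma smooth_on_neq0 V f p : open V -> V p -> smooth_on A V f -> f p != 0 ->
  exists U, [/\ open U, U p, U `<=` V & forall q, U q -> f q != 0].
Proof.
move=> oV Vp sf fp0; have [_ _ charts /(_ p)[c Ac dp] _] := hM.
have [odom _ _ map_cont _] := charts c Ac.
have [sr si] := sf c Ac.
pose S := chart_map c @` (V `&` chart_dom c).
have oS : open S by exact: open_chart_image.
have Sp : S (chart_map c p) by exists p.
pose h := fun x => sqr_modulus (f (chart_inv c x)).
have sh : smooth_real S h := smooth_realD oS (smooth_realM oS sr sr)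
  (smooth_realM oS si si).
have h0 : h (chart_map c p) != 0 by rewrite /h chart_mapK // sqr_modulus_eq0.
have hcont := differentiable_continuous (smooth_real_diff sh Sp).
have nh : \forall x \near chart_map c p, h x != 0.
  have := hcont [set y | y != 0]; apply.
  by apply: open_nbhs_nbhs; split; [exact: open_neq|exact: h0].
rewrite continuous_open_subspace // in map_cont.
have nh' : \forall q \near p, h (chart_map c q) != 0.
  have := map_cont _ (mem_set dp) [set x | h x != 0]; exact.
have nd : \forall q \near p, chart_dom c q by exact: open_nbhs_nbhs.
have nV : \forall q \near p, V q by exact: open_nbhs_nbhs.
have : nbhs p [set q | [/\ h (chart_map c q) != 0, chart_dom c q & V q]].
  by near=> q => /=; split; near: q.
rewrite nbhsE => -[U [oU Up] sU]; exists U; split=> // q /sU[hq dq Vq] //.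
by move: hq; rewrite /= /h chart_mapK // sqr_modulus_eq0.
Unshelve. all: by end_near. Qed.

Lemma lincombE n (e : 'I_n -> tvec R M) (a : 'rV[R[i]]_n) f :
  lincomb e a f = \sum_(i < n) a 0 i * e i f.
Proof. by rewrite /lincomb fct_sumE. Qed.

Lemma coord_vecE V f c p i : open V -> V p -> smooth_on A V f ->
  coord_vec A c p i f = partialC i (f \o chart_inv c) (chart_map c p).
Proof.
move=> oV Vp sf; rewrite /coord_vec; case: asboolP => // -[].
exact: smooth_on_near sf.
Qed.

(** Derivatives see only germs. Smoothness of f selects the derivative branch of [coord_vec], and it
    passes to g because both agree on the open set V. *)
Lemma tangent_ext V f g p v : open V -> V p -> tangent A p v ->
  (forall q, V q -> f q = g q) -> smooth_on A V f -> v f = v g.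
Proof.
move=> oV Vp [c [Ac dp [a _ <-]]] fg sf; rewrite !lincombE.
apply: eq_bigr => i _; congr (_ * _).
rewrite (coord_vecE _ _ oV Vp sf).
rewrite (coord_vecE _ _ oV Vp (smooth_on_ext oV fg sf)).
apply: (partialC_ext _ (open_chart_image oV Ac)); last by exists p.
by move=> _ [q [Vq dq] <-]; rewrite /= chart_mapK // fg.
Qed.

Lemma tangent_cst p v (a : R[i]) : tangent A p v -> v (fun=> a) = 0.
Proof.
move=> [c [Ac dp [b _ <-]]]; rewrite lincombE big1 // => i _.
rewrite (coord_vecE _ _ openT I (smooth_on_cst a openT)).
by rewrite (_ : _ \o _ = fun=> a) // partialC_cst mulr0.
Qed.

Lemma tangentD V f g p v : open V -> V p -> tangent A p v ->
  smooth_on A V f -> smooth_on A V g -> v (fun q => f q + g q) = v f + v g.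
Proof.
move=> oV Vp [c [Ac dp [b _ <-]]] sf sg; rewrite !lincombE -big_split /=.
apply: eq_bigr => i _; rewrite -mulrDr; congr (_ * _).
rewrite (coord_vecE _ _ oV Vp sf) (coord_vecE _ _ oV Vp sg).
rewrite (coord_vecE _ _ oV Vp (smooth_onD oV sf sg)).
by apply: (partialCD _ (sf c Ac) (sg c Ac)); exists p.
Qed.

Lemma tangentM V f g p v : open V -> V p -> tangent A p v ->
  smooth_on A V f -> smooth_on A V g ->
  v (fun q => f q * g q) = v f * g p + f p * v g.
Proof.
move=> oV Vp [c [Ac dp [b _ <-]]] sf sg; rewrite !lincombE.
rewrite mulr_suml mulr_sumr -big_split /=.
apply: eq_bigr => i _; rewrite -mulrA [f p * _]mulrCA -mulrDr; congr (_ * _).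
rewrite (coord_vecE _ _ oV Vp sf) (coord_vecE _ _ oV Vp sg).
rewrite (coord_vecE _ _ oV Vp (smooth_onM oV sf sg)).
have /= -> := partialCM i (sf c Ac) (sg c Ac) (ex_intro2 _ _ p (conj Vp dp) erefl).
by rewrite /= chart_mapK.
Qed.

Lemma tangentN V f p v : open V -> V p -> tangent A p v ->
  smooth_on A V f -> v (fun q => - f q) = - v f.
Proof.
move=> oV Vp tv sf; have sN := smooth_onM oV (smooth_on_cst (-1) oV) sf.
rewrite -(tangent_ext oV Vp tv _ sN); last by move=> q _; rewrite mulN1r.
rewrite (tangentM oV Vp tv (smooth_on_cst _ oV) sf) (tangent_cst _ tv).
by rewrite mul0r add0r mulN1r.
Qed.

Lemma tangentB V f g p v : open V -> V p -> tangent A p v ->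
  smooth_on A V f -> smooth_on A V g -> v (fun q => f q - g q) = v f - v g.
Proof.
move=> oV Vp tv sf sg.
by rewrite (tangentD oV Vp tv sf (smooth_onN oV sg)) (tangentN oV Vp tv sg).
Qed.

End SmoothFunctions.

(** * Vector fields and torsion-free connections *)

Section Fields.
Context {R : realType} {M : topologicalType} (A : set (chart R M)).
Hypothesis hM : smooth_manifold A.
Variable V : set M.
Hypothesis oV : open V.
Hypothesis tangent_lin : forall p, V p -> forall (a : R[i]) u v,
  tangent A p u -> tangent A p v -> tangent A p (a *: u + v).
Local Notation vf := (vfield_on A V).
Local Notation sm := (smooth_on A V).
Implicit Types (X Y Z : vfield R M) (f h : M -> R[i]).

Lemma tvecP (u v : tvec R M) : (forall f, u f = v f :> R[i]) -> u = v.
Proof. by move=> uv; apply/funext. Qed.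

Lemma tvecD (u v : tvec R M) f : (u + v) f = (u f : R[i]) + v f. Proof. by []. Qed.
Lemma tvecN (u : tvec R M) f : (- u) f = - (u f : R[i]). Proof. by []. Qed.
Lemma tvecZ (a : R[i]) (u : tvec R M) f : (a *: u) f = a * (u f : R[i]).
Proof. by []. Qed.
Lemma tvec0 f : (0 : tvec R M) f = (0 : R[i]). Proof. by []. Qed.
Definition tvecE := (tvecD, tvecN, tvecZ, tvec0).

Lemma vf_tangent X p : vf X -> V p -> tangent A p (X p).
Proof. by case=> tX _; exact: tX. Qed.

Lemma vf_smooth X f : vf X -> sm f -> sm (fun q => X q f).
Proof. by case=> _ sX sf; exact: (sX V f oV (@subset_refl _ V) sf). Qed.

Lemma vf_ext X X' : vf X -> (forall p, V p -> X p = X' p) -> vf X'.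
Proof.
move=> [tX sX] XX'; split=> [p Vp|W f oW WV sf]; first by rewrite -XX' //; exact: tX.
apply: (smooth_on_ext hM oW _ (sX W f oW WV sf)) => p Wp.
by rewrite /apply_field XX' //; exact: WV.
Qed.

Lemma vf_lin f X X' : sm f -> vf X -> vf X' -> vf (fun q => f q *: X q + X' q).
Proof.
move=> sf [tX sX] [tX' sX']; split=> [p Vp|W h oW WV sh].
  by apply: tangent_lin => //; [exact: tX|exact: tX'].
rewrite (_ : apply_field _ h = fun q => f q * X q h + X' q h) //.
apply: smooth_onD => //; last exact: sX'.
by apply: smooth_onM => //; [exact: smooth_onS sf|exact: sX].
Qed.

Lemma tangent0 p : tangent A p 0.
Proof.
have [_ _ _ /(_ p)[c Ac dp] _] := hM; exists c; split=> //; exists 0 => //.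
by rewrite /lincomb big1 // => i _; rewrite mxE scale0r.
Qed.

Lemma vf0 : vf (fun=> 0).
Proof.
split=> [p _|W f oW _ _]; first exact: tangent0.
exact: (smooth_on_cst hM (0 : R[i]) oW).
Qed.

Lemma vf_actD X f h p : vf X -> sm f -> sm h -> V p ->
  X p (fun q => f q + h q) = (X p f : R[i]) + X p h.
Proof. by move=> vX sf sh Vp; exact: (tangentD hM oV Vp (vf_tangent vX Vp) sf sh). Qed.

Lemma vf_actB X f h p : vf X -> sm f -> sm h -> V p ->
  X p (fun q => f q - h q) = (X p f : R[i]) - X p h.
Proof. by move=> vX sf sh Vp; exact: (tangentB hM oV Vp (vf_tangent vX Vp) sf sh). Qed.

Lemma vf_actM X f h p : vf X -> sm f -> sm h -> V p ->
  X p (fun q => f q * h q) = (X p f : R[i]) * h p + f p * X p h.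
Proof. by move=> vX sf sh Vp; exact: (tangentM hM oV Vp (vf_tangent vX Vp) sf sh). Qed.

Lemma vf_act_cst X (a : R[i]) p : vf X -> V p -> X p (fun=> a) = 0 :> R[i].
Proof. by move=> vX Vp; exact: (tangent_cst hM a (vf_tangent vX Vp)). Qed.

Lemma vf_act_ext X f h p : vf X -> sm f -> (forall q, V q -> f q = h q) ->
  V p -> X p f = X p h :> R[i].
Proof. by move=> vX sf fh Vp; exact: (tangent_ext hM oV Vp (vf_tangent vX Vp) fh sf). Qed.

Lemma lieE X Y f p : sm f -> V p ->
  lie A X Y p f = (X p (fun q => Y q f) : R[i]) - Y p (fun q => X q f).
Proof.
move=> sf Vp; rewrite /lie; case: asboolP => // -[]; exact: smooth_on_near sf.
Qed.

Lemma lie_nsmooth X Y f p : ~ smooth_near A p f -> lie A X Y p f = 0 :> R[i].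
Proof. by rewrite /lie; case: asboolP. Qed.

(* Below, S is the set of sections over V of either the tangent bundle or N. *)
Definition field_module (S : vfield R M -> Prop) : Prop :=
  [/\ forall X, S X -> vf X,
      forall f X X', sm f -> S X -> S X' -> S (fun q => f q *: X q + X' q),
      forall X X', S X -> (forall p, V p -> X p = X' p) -> S X' &
      S (fun=> 0)].

Lemma vf_module : field_module vf.
Proof. split=> //; [exact: vf_lin|exact: vf_ext|exact: vf0]. Qed.

(** One notion serves the Levi-Civita and Weyl connections, with S all vector fields over V, and the
    partial connection on N, with S its sections; the curvature calculus is then done once. *)
Definition torsion_free_connection_on (S : vfield R M -> Prop)
    (D : vfield R M -> vfield R M -> vfield R M) : Prop :=
  [/\ forall X Y, S X -> S Y -> S (D X Y),
      forall X X' Y Y', S X -> S X' -> S Y -> S Y' ->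
        (forall p, V p -> X p = X' p) -> (forall p, V p -> Y p = Y' p) ->
        forall p, V p -> D X Y p = D X' Y' p,
      forall f X X' Y, sm f -> S X -> S X' -> S Y -> forall p, V p ->
        D (fun q => f q *: X q + X' q) Y p = f p *: D X Y p + D X' Y p,
      forall f X Y Y', sm f -> S X -> S Y -> S Y' -> forall p, V p ->
        D X (fun q => f q *: Y q + Y' q) p =
          X p f *: Y p + f p *: D X Y p + D X Y' p &
      forall X Y, S X -> S Y -> forall p, V p ->
        D X Y p - D Y X p = lie A X Y p].

(** * Curvature calculus of a torsion-free connection *)

Section Connection.
Variables (S : vfield R M -> Prop) (D : vfield R M -> vfield R M -> vfield R M).
Hypotheses (hS : field_module S) (hD : torsion_free_connection_on S D).

Lemma mod_vf X : S X -> vf X. Proof. by case: hS => + _ _ _; apply. Qed.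
Lemma mod_lin f X X' : sm f -> S X -> S X' -> S (fun q => f q *: X q + X' q).
Proof. by case: hS => _ + _ _; apply. Qed.
Lemma mod_ext X X' : S X -> (forall p, V p -> X p = X' p) -> S X'.
Proof. by case: hS => _ _ + _; apply. Qed.
Lemma mod0 : S (fun=> 0). Proof. by case: hS. Qed.
Lemma smooth_cst (a : R[i]) : sm (fun=> a). Proof. exact (smooth_on_cst hM a oV). Qed.

Lemma modZ f X : sm f -> S X -> S (fun q => f q *: X q).
Proof.
move=> sf SX; apply: mod_ext (mod_lin sf SX mod0) _ => p _.
by rewrite addr0.
Qed.
Lemma modD X Y : S X -> S Y -> S (fun q => X q + Y q).
Proof.
move=> SX SY; apply: mod_ext (mod_lin (smooth_cst 1) SX SY) _ => p _.
by rewrite scale1r.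
Qed.
Lemma modN X : S X -> S (fun q => - X q).
Proof.
move=> SX; apply: mod_ext (modZ (smooth_cst (-1)) SX) _ => p _.
by rewrite scaleN1r.
Qed.
Lemma modB X Y : S X -> S Y -> S (fun q => X q - Y q).
Proof. by move=> SX SY; exact: modD SX (modN SY). Qed.

Lemma conn_closed X Y : S X -> S Y -> S (D X Y).
Proof. by case: hD => + _ _ _ _; apply. Qed.

Lemma conn_ext X X' Y Y' p : S X -> S Y ->
  (forall p, V p -> X p = X' p) -> (forall p, V p -> Y p = Y' p) -> V p ->
  D X Y p = D X' Y' p.
Proof.
case: hD => _ ext _ _ _ SX SY XX YY; apply: ext => //.
  exact: mod_ext SX XX.
exact: mod_ext SY YY.
Qed.

Lemma conn_extl X X' Y p : S X -> S Y ->
  (forall p, V p -> X p = X' p) -> V p -> D X Y p = D X' Y p.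
Proof. by move=> SX SY XX; exact: conn_ext. Qed.

Lemma conn_extr X Y Y' p : S X -> S Y ->
  (forall p, V p -> Y p = Y' p) -> V p -> D X Y p = D X Y' p.
Proof. by move=> SX SY YY; exact: conn_ext. Qed.

Lemma conn_linl f X X' Y p : sm f -> S X -> S X' -> S Y -> V p ->
  D (fun q => f q *: X q + X' q) Y p = f p *: D X Y p + D X' Y p.
Proof. by case: hD => _ _ + _ _ sf SX SX' SY; apply. Qed.

Lemma conn_linr f X Y Y' p : sm f -> S X -> S Y -> S Y' -> V p ->
  D X (fun q => f q *: Y q + Y' q) p =
    X p f *: Y p + f p *: D X Y p + D X Y' p.
Proof. by case: hD => _ _ _ + _ sf SX SY SY'; apply. Qed.

Lemma conn_torsion X Y p : S X -> S Y -> V p ->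
  lie A X Y p = D X Y p - D Y X p.
Proof. by case: hD => _ _ _ _ tD SX SY Vp; rewrite tD. Qed.

Lemma conn0l Y p : S Y -> V p -> D (fun=> 0) Y p = 0.
Proof.
(* With coefficient -1 and both fields 0, linearity reads D_0 Y = - D_0 Y + D_0 Y = 0, after
   rewriting -1 times 0 plus 0 as 0. *)
move=> SY Vp; have E0 := conn_linl (smooth_cst (-1)) mod0 mod0 SY Vp.
have {}E0 := etrans E0 (etrans (congr1 (+%R^~ _) (scaleN1r _)) (addNr _)).
rewrite -{}[RHS]E0; apply: conn_extl => //; first exact: mod0.
by move=> q _; rewrite scaler0 addr0.
Qed.

Lemma conn0r X p : S X -> V p -> D X (fun=> 0) p = 0.
Proof.
move=> SX Vp; have := conn_linr (smooth_cst (-1)) SX mod0 mod0 Vp.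
rewrite [X p _ *: _]scaler0 add0r [X in _ = X + _]scaleN1r [RHS]addNr => E0.
rewrite -{}[RHS]E0; apply: conn_extr => //; first exact: mod0.
by move=> q _; rewrite scaler0 addr0.
Qed.

Lemma connZl f X Y p : sm f -> S X -> S Y -> V p ->
  D (fun q => f q *: X q) Y p = f p *: D X Y p.
Proof.
move=> sf SX SY Vp; rewrite -[RHS]addr0 -(conn0l SY Vp) -conn_linl //; last exact: mod0.
by apply: conn_extl => //; [exact: modZ|move=> q _; rewrite addr0].
Qed.

Lemma connDl X X' Y p : S X -> S X' -> S Y -> V p ->
  D (fun q => X q + X' q) Y p = D X Y p + D X' Y p.
Proof.
move=> SX SX' SY Vp; rewrite -[X in X + _]scale1r.
rewrite -(conn_linl (smooth_cst 1) SX SX' SY Vp).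
by apply: conn_extl => //; [exact: modD|move=> q _; rewrite scale1r].
Qed.

Lemma connBl X X' Y p : S X -> S X' -> S Y -> V p ->
  D (fun q => X q - X' q) Y p = D X Y p - D X' Y p.
Proof.
move=> SX SX' SY Vp; rewrite connDl //; last exact: modN.
congr (_ + _); rewrite -scaleN1r -(connZl (smooth_cst (-1)) SX' SY Vp).
by apply: conn_extl => //; [exact: modN|move=> q _; rewrite scaleN1r].
Qed.

Lemma connZr f X Y p : sm f -> S X -> S Y -> V p ->
  D X (fun q => f q *: Y q) p = X p f *: Y p + f p *: D X Y p.
Proof.
move=> sf SX SY Vp; rewrite -[RHS]addr0 -(conn0r SX Vp) -conn_linr //; last exact: mod0.
by apply: conn_extr => //; [exact: modZ|move=> q _; rewrite addr0].
Qed.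

Lemma connDr X Y Y' p : S X -> S Y -> S Y' -> V p ->
  D X (fun q => Y q + Y' q) p = D X Y p + D X Y' p.
Proof.
move=> SX SY SY' Vp; have := conn_linr (smooth_cst 1) SX SY SY' Vp.
rewrite /= (vf_act_cst _ (mod_vf SX) Vp) scale0r add0r scale1r => <-.
by apply: conn_extr => //; [exact: modD|move=> q _; rewrite scale1r].
Qed.

Lemma connBr X Y Y' p : S X -> S Y -> S Y' -> V p ->
  D X (fun q => Y q - Y' q) p = D X Y p - D X Y' p.
Proof.
move=> SX SY SY' Vp; rewrite connDr //; last exact: modN.
congr (_ + _); have := connZr (smooth_cst (-1)) SX SY' Vp.
rewrite /= (vf_act_cst _ (mod_vf SX) Vp) scale0r add0r scaleN1r => <-.
by apply: conn_extr => //; [exact: modN|move=> q _; rewrite scaleN1r].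
Qed.

(** Zero torsion makes the bracket a difference of two covariant derivatives, each of which stays in
    S. *)
Lemma lie_closed X Y : S X -> S Y -> S (lie A X Y).
Proof.
move=> SX SY; apply: mod_ext (modB (conn_closed SX SY) (conn_closed SY SX)) _.
by move=> p Vp; rewrite (conn_torsion SX SY Vp).
Qed.

Lemma curvature_closed X Y Z : S X -> S Y -> S Z -> S (curvature A D X Y Z).
Proof.
move=> SX SY SZ; have cl := conn_closed.
apply: modB; last exact: cl (lie_closed SX SY) SZ.
by apply: modB; [exact: cl SX (cl _ _ SY SZ)|exact: cl SY (cl _ _ SX SZ)].
Qed.

Lemma curvatureN X Y Z p : S X -> S Y -> S Z -> V p ->
  curvature A D X Y Z p = - curvature A D Y X Z p.
Proof.
move=> SX SY SZ Vp; rewrite /curvature.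
have -> : D (lie A X Y) Z p = - D (lie A Y X) Z p.
  rewrite -scaleN1r -(connZl (smooth_cst (-1)) (lie_closed SY SX) SZ Vp).
  apply: conn_extl => //; first exact: lie_closed.
  by move=> q Vq; rewrite !conn_torsion // scaleN1r opprB.
by rewrite !opprD !opprK [- _ + _]addrC.
Qed.

Lemma curvature_ext X X' Y Y' Z Z' p : S X -> S Y -> S Z ->
  (forall p, V p -> X p = X' p) -> (forall p, V p -> Y p = Y' p) ->
  (forall p, V p -> Z p = Z' p) -> V p ->
  curvature A D X Y Z p = curvature A D X' Y' Z' p.
Proof.
move=> SX SY SZ XX YY ZZ Vp; rewrite /curvature; congr (_ - _ - _).
- apply: conn_ext => //; first exact: conn_closed.
  by move=> q Vq; exact: conn_ext.
- apply: conn_ext => //; first exact: conn_closed.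
  by move=> q Vq; exact: conn_ext.
- apply: conn_ext => //; first exact: lie_closed.
  move=> q Vq; have [SX' SY'] := (mod_ext SX XX, mod_ext SY YY).
  by rewrite !conn_torsion //; congr (_ - _); exact: conn_ext.
Qed.

(** Expanding the double Leibniz rule, the mixed first-order terms cancel in pairs and X(Y f) - Y(X
    f) cancels against the derivative of f along the bracket. *)
Lemma curvature_linr f X Y Z Z' p : sm f -> S X -> S Y -> S Z -> S Z' -> V p ->
  curvature A D X Y (fun q => f q *: Z q + Z' q) p =
    f p *: curvature A D X Y Z p + curvature A D X Y Z' p.
Proof.
move=> sf SX SY SZ SZ' Vp; rewrite /curvature.
have cl := conn_closed; have sa X0 (SX0 : S X0) := vf_smooth (mod_vf SX0) sf.
have DD X0 Y0 : S X0 -> S Y0 ->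
    D X0 (D Y0 (fun q => f q *: Z q + Z' q)) p =
    X0 p (fun q => Y0 q f) *: Z p + Y0 p f *: D X0 Z p
    + (X0 p f *: D Y0 Z p + f p *: D X0 (D Y0 Z) p) + D X0 (D Y0 Z') p.
  move=> SX0 SY0; rewrite (conn_extr (Y' := fun q =>
    (Y0 q f *: Z q + f q *: D Y0 Z q) + D Y0 Z' q)) //.
  - rewrite connDr //; last 2 first.
    + by apply: modD; apply: modZ => //; [exact: sa|exact: cl].
    + exact: cl.
    rewrite connDr //; last 2 first.
    + by apply: modZ => //; exact: sa.
    + by apply: modZ => //; exact: cl.
    by rewrite (connZr (sa _ SY0)) // connZr //; exact: cl.
  - by apply: cl => //; exact: mod_lin.
  - by move=> q Vq; rewrite conn_linr.
rewrite !DD // conn_linr //; last exact: lie_closed.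
(* Vectors are operators on functions, so an identity between them is checked on every test
   function, where it becomes scalar and [ring] applies. *)
apply: tvecP => h; rewrite (lieE _ _ sf Vp) !tvecE; ring.
Qed.

(** The term (Y f) D_X Z produced by D_Y(f D_X Z) is compensated by [f X, Y] = f [X, Y] - (Y f)
    X. *)
Lemma curvature_linl f X X' Y Z p : sm f -> S X -> S X' -> S Y -> S Z -> V p ->
  curvature A D (fun q => f q *: X q + X' q) Y Z p =
    f p *: curvature A D X Y Z p + curvature A D X' Y Z p.
Proof.
move=> sf SX SX' SY SZ Vp; rewrite /curvature.
have cl := conn_closed; have sY := vf_smooth (mod_vf SY) sf.
have -> : D Y (D (fun q => f q *: X q + X' q) Z) p =
    Y p f *: D X Z p + f p *: D Y (D X Z) p + D Y (D X' Z) p.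
  rewrite -conn_linr //; try exact: cl.
  apply: conn_extr => //; first by apply: cl => //; exact: mod_lin.
  by move=> q Vq; rewrite conn_linl.
have -> : D (lie A (fun q => f q *: X q + X' q) Y) Z p =
    f p *: D (lie A X Y) Z p + (D (lie A X' Y) Z p - Y p f *: D X Z p).
  have SL := lie_closed.
  rewrite (conn_extl (X' := fun q => f q *: lie A X Y q
    + (lie A X' Y q - Y q f *: X q))) //.
  - rewrite conn_linl //; [|exact: SL|].
      rewrite connBl //; [|exact: SL|exact: modZ].
      by rewrite (connZl sY).
    by apply: modB; [exact: SL|exact: modZ].
  - by apply: SL => //; exact: mod_lin.
  - move=> q Vq; rewrite conn_torsion //; last exact: mod_lin.
    rewrite conn_linl // conn_linr // !conn_torsion //.
    by apply: tvecP => h; rewrite !tvecE; ring.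
rewrite conn_linl //; last exact: cl.
by apply: tvecP => h; rewrite !tvecE; ring.
Qed.

Lemma curvature_linm f X Y Y' Z p : sm f -> S X -> S Y -> S Y' -> S Z -> V p ->
  curvature A D X (fun q => f q *: Y q + Y' q) Z p =
    f p *: curvature A D X Y Z p + curvature A D X Y' Z p.
Proof.
move=> sf SX SY SY' SZ Vp; rewrite curvatureN //; last exact: mod_lin.
rewrite curvature_linl // [in RHS]curvatureN // [X in _ = _ + X]curvatureN //.
by rewrite scalerN opprD.
Qed.

(** Zero torsion gives [X, [Y, Z]] = D_X D_Y Z - D_X D_Z Y - D_[Y, Z] X; summed cyclically, the
    right-hand sides regroup into the cyclic sum of curvatures, so the identity is equivalent to
    Jacobi. *)
Lemma first_bianchi X Y Z p : S X -> S Y -> S Z -> V p ->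
  (lie A X (lie A Y Z) p + lie A Y (lie A Z X) p + lie A Z (lie A X Y) p = 0) ->
  curvature A D X Y Z p + curvature A D Y Z X p + curvature A D Z X Y p = 0.
Proof.
move=> SX SY SZ Vp <-; have [cl SL] := (conn_closed, lie_closed).
have DD X0 Y0 Z0 : S X0 -> S Y0 -> S Z0 ->
    D X0 (lie A Y0 Z0) p = D X0 (D Y0 Z0) p - D X0 (D Z0 Y0) p.
  move=> SX0 SY0 SZ0; rewrite -connBr //; try exact: cl.
  apply: conn_extr => //; first exact: SL.
  by move=> q Vq; rewrite conn_torsion.
rewrite !(conn_torsion _ (SL _ _ _ _) Vp) // !DD // /curvature.
by apply: tvecP => f; rewrite !tvecE; ring.
Qed.

End Connection.

Lemma lie_jacobi_smooth X Y Z f p : vf X -> vf Y -> vf Z -> sm f -> V p ->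
  (lie A X (lie A Y Z) p f : R[i]) + lie A Y (lie A Z X) p f
  + lie A Z (lie A X Y) p f = 0.
Proof.
move=> vX vY vZ sf Vp; rewrite !(lieE _ _ sf Vp).
have s X0 h : vf X0 -> sm h -> sm (fun q => X0 q h) by exact: vf_smooth.
have LL X0 Y0 Z0 : vf X0 -> vf Y0 -> vf Z0 ->
    X0 p (fun q => lie A Y0 Z0 q f) =
    (X0 p (fun q => Y0 q (fun r => Z0 r f)) : R[i])
    - X0 p (fun q => Z0 q (fun r => Y0 r f)).
  move=> vX0 vY0 vZ0; rewrite -(vf_actB vX0 (s _ _ vY0 (s _ _ vZ0 sf)) (s _ _ vZ0 (s _ _ vY0 sf)) Vp).
  symmetry; apply: vf_act_ext => //; last by move=> q Vq; rewrite lieE.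
  exact (smooth_onB hM oV (s _ _ vY0 (s _ _ vZ0 sf)) (s _ _ vZ0 (s _ _ vY0 sf))).
rewrite !LL // !(lieE _ _ (s _ _ _ sf) Vp) //.
by ring.
Qed.

End Fields.

Lemma vfield_onS (R : realType) (M : topologicalType) (A : set (chart R M))
    (U V : set M) X : U `<=` V -> vfield_on A V X -> vfield_on A U X.
Proof.
move=> UV [tX sX]; split=> [p /UV|W f oW WU]; first exact: tX.
by apply: sX => //; exact: subset_trans UV.
Qed.

(** * Metrics and connections that preserve them up to scale *)

Section Metric.
Context {R : realType} {M : topologicalType} (A : set (chart R M)).
Hypothesis hM : smooth_manifold A.
Variable V : set M.
Hypothesis oV : open V.
Hypothesis tangent_lin : forall p, V p -> forall (a : R[i]) u v,
  tangent A p u -> tangent A p v -> tangent A p (a *: u + v).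
Local Notation vf := (vfield_on A V).
Local Notation sm := (smooth_on A V).
Local Notation tfc := (torsion_free_connection_on A V).
Implicit Types (X Y Z T : vfield R M) (f h : M -> R[i]).

(** A test function may be smooth only on some neighbourhood U of p, so the computation takes place
    on the intersection of U and V. On functions not smooth near p every bracket is 0 by
    convention. *)
Lemma lie_jacobi X Y Z p : vf X -> vf Y -> vf Z -> V p ->
  lie A X (lie A Y Z) p + lie A Y (lie A Z X) p + lie A Z (lie A X Y) p = 0.
Proof.
move=> vX vY vZ Vp; apply: tvecP => f; rewrite !tvecE.
have [[U [oU Up sf]]|nf] := pselect (smooth_near A p f); last first.
  by rewrite !lie_nsmooth // !addr0.
have oUV : open (U `&` V) by exact: openI.
apply: (@lie_jacobi_smooth _ _ A hM (U `&` V)) => //; first exact: vfield_onS vX.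
- exact: vfield_onS vY.
- exact: vfield_onS vZ.
- exact: smooth_onS sf.
Qed.

Variable g : M -> tvec R M -> tvec R M -> R[i].
Hypothesis hg : complex_metric A g.

Section Pointwise.
Variable p : M.
Hypothesis Vp : V p.
Local Notation tg := (tangent A p).

Lemma tangent_closedD u v : tg u -> tg v -> tg (u + v).
Proof. by move=> tu tv; have := tangent_lin Vp 1 tu tv; rewrite scale1r. Qed.
Lemma tangent_closedZ a u : tg u -> tg (a *: u).
Proof.
move=> tu; have := tangent_lin Vp a tu (tangent0 hM p); by rewrite addr0.
Qed.
Lemma tangent_closedN u : tg u -> tg (- u).
Proof. by move=> tu; rewrite -scaleN1r; exact: tangent_closedZ. Qed.
Lemma tangent_closedB u v : tg u -> tg v -> tg (u - v).
Proof. by move=> tu tv; exact: tangent_closedD tu (tangent_closedN tv). Qed.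

Lemma metricC u v : tg u -> tg v -> g p u v = g p v u.
Proof. by case: hg => _ sym _ _; exact: sym. Qed.
Lemma metricDl u v w : tg u -> tg v -> tg w -> g p (u + v) w = g p u w + g p v w.
Proof.
by case: hg => lin _ _ _ tu tv tw; have := lin p 1 u v w tu tv tw; rewrite scale1r mul1r.
Qed.
Lemma metric0l w : tg w -> g p 0 w = 0.
Proof.
move=> tw; have := metricDl (tangent0 hM p) (tangent0 hM p) tw.
by rewrite addr0 => /eqP; rewrite -subr_eq0 opprD addrA subrr sub0r oppr_eq0 => /eqP.
Qed.
Lemma metricZl a u w : tg u -> tg w -> g p (a *: u) w = a * g p u w.
Proof.
case: (hg) => lin _ _ _ tu tw; have := lin p a u 0 w tu (tangent0 hM p) tw.
by rewrite addr0 metric0l // addr0.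
Qed.
Lemma metricNl u w : tg u -> tg w -> g p (- u) w = - g p u w.
Proof. by move=> tu tw; rewrite -scaleN1r metricZl // mulN1r. Qed.
Lemma metricBl u v w : tg u -> tg v -> tg w -> g p (u - v) w = g p u w - g p v w.
Proof. by move=> tu tv tw; rewrite metricDl ?metricNl //; exact: tangent_closedN. Qed.
Lemma metricDr u v w : tg u -> tg v -> tg w -> g p w (u + v) = g p w u + g p w v.
Proof.
by move=> tu tv tw; rewrite metricC ?metricDl ?(metricC tw) //; exact: tangent_closedD.
Qed.
Lemma metricZr a u w : tg u -> tg w -> g p w (a *: u) = a * g p w u.
Proof. by move=> tu tw; rewrite metricC ?metricZl ?(metricC tw) //; exact: tangent_closedZ. Qed.
Lemma metricNr u w : tg u -> tg w -> g p w (- u) = - g p w u.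
Proof. by move=> tu tw; rewrite -scaleN1r metricZr // mulN1r. Qed.
Lemma metricBr u v w : tg u -> tg v -> tg w -> g p w (u - v) = g p w u - g p w v.
Proof. by move=> tu tv tw; rewrite metricDr ?metricNr //; exact: tangent_closedN. Qed.

End Pointwise.

Lemma metric_smooth X Y : vf X -> vf Y -> sm (fun q => g q (X q) (Y q)).
Proof. by move=> vX vY; case: hg => _ _ _; apply. Qed.

(* [D g = - 2 b (x) g] on V, the case [b = 0] being that of a metric connection. *)
Definition weyl_compatible (D : vfield R M -> vfield R M -> vfield R M)
    (b : vfield R M -> M -> R[i]) : Prop :=
  (forall X, vf X -> sm (b X)) /\
  forall X Y Z p, vf X -> vf Y -> vf Z -> V p ->
    (X p (fun q => g q (Y q) (Z q)) : R[i]) =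
    g p (D X Y p) (Z p) + g p (Y p) (D X Z p) - 2%:R * (b X p * g p (Y p) (Z p)).

Definition ext_deriv (b : vfield R M -> M -> R[i]) X Y p : R[i] :=
  (X p (b Y) : R[i]) - Y p (b X) - b (lie A X Y) p.

(** The function g(Z, T) is differentiated along [X, Y] in two ways: as a commutator of second
    derivatives, each expanded twice by compatibility, and directly by compatibility along the
    bracket. Terms quadratic in b cancel in the commutator. *)
Lemma curvature_metric D b X Y Z T p : tfc vf D -> weyl_compatible D b ->
  vf X -> vf Y -> vf Z -> vf T -> V p ->
  g p (curvature A D X Y Z p) (T p) + g p (Z p) (curvature A D X Y T p) =
  2%:R * ext_deriv b X Y p * g p (Z p) (T p).
Proof.
move=> hD [sb hb] vX vY vZ vT Vp.
have vm := vf_module hM tangent_lin.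
have cl := conn_closed hD; have tn K (vK : vf K) := vf_tangent vK Vp.
have vL := lie_closed hM oV vm hD vX vY.
have sG K L (vK : vf K) (vL : vf L) := metric_smooth vK vL.
have sM := smooth_onM hM oV; have s2 := smooth_on_cst hM (2%:R : R[i]) oV.
have XYG K L : vf K -> vf L ->
   (K p (fun q => L q (fun r => g r (Z r) (T r))) : R[i]) =
   (g p (D K (D L Z) p) (T p) + g p (D L Z p) (D K T p)
     - 2%:R * (b K p * g p (D L Z p) (T p)))
   + (g p (D K Z p) (D L T p) + g p (Z p) (D K (D L T) p)
     - 2%:R * (b K p * g p (Z p) (D L T p)))
   - 2%:R * ((K p (b L) : R[i]) * g p (Z p) (T p) + b L p *
      (g p (D K Z p) (T p) + g p (Z p) (D K T p) - 2%:R * (b K p * g p (Z p) (T p)))).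
  move=> vK vL'; have [sbL sGG] := (sb _ vL', sG _ _ vZ vT).
  have [s1 s3] := (sG _ _ (cl _ _ vL' vZ) vT, sG _ _ vZ (cl _ _ vL' vT)).
  have s4 := sM _ _ s2 (sM _ _ sbL sGG).
  have := vf_act_ext hM oV vK (vf_smooth oV vL' sGG) (fun q Vq => hb L Z T q vL' vZ vT Vq) Vp.
  move=> ->; rewrite (vf_actB hM oV vK (smooth_onD hM oV s1 s3) s4 Vp).
  rewrite (vf_actD hM oV vK s1 s3 Vp).
  rewrite (vf_actM hM oV vK s2 (sM _ _ sbL sGG) Vp) (vf_act_cst hM _ vK Vp).
  rewrite (vf_actM hM oV vK sbL sGG Vp).
  by rewrite !hb //; [ring|exact: cl|exact: cl].
have := lieE oV X Y (sG _ _ vZ vT) Vp.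
rewrite (XYG _ _ vX vY) (XYG _ _ vY vX) (hb _ _ _ _ vL vZ vT Vp).
have [tZ tT] := (tn _ vZ, tn _ vT).
have cc K L Q : vf K -> vf L -> vf Q -> tangent A p (D K (D L Q) p).
  by move=> vK vL' vQ; exact (tn _ (cl _ _ vK (cl _ _ vL' vQ))).
have c1 Q : vf Q -> tangent A p (D (lie A X Y) Q p) by move=> vQ; exact (tn _ (cl _ _ vL vQ)).
rewrite /curvature /ext_deriv.
have tB := @tangent_closedB p Vp.
rewrite !(metricBl Vp) ?(metricBr Vp); auto.
move=> E; apply/eqP; rewrite -subr_eq0; move/eqP: E; rewrite eq_sym -subr_eq0.
move=> /eqP E; apply/eqP; rewrite -[RHS]E; ring.
Qed.

(* Koszul's trick, applied to the difference of the two connections. *)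
Lemma weyl_compatible_diff D D' b X Y Z p :
  tfc vf D -> weyl_compatible D b -> tfc vf D' -> weyl_compatible D' (fun _ _ => 0) ->
  vf X -> vf Y -> vf Z -> V p ->
  g p (D X Y p) (Z p) - g p (D' X Y p) (Z p) =
  b X p * g p (Y p) (Z p) + b Y p * g p (X p) (Z p) - b Z p * g p (X p) (Y p).
Proof.
move=> hD [_ hb] hD' [_ hb'] vX vY vZ Vp.
have vm := vf_module hM tangent_lin.
have tn K (vK : vf K) := vf_tangent vK Vp.
have tD K L : vf K -> vf L -> tangent A p (D K L p).
  by move=> vK vL; apply/tn/(conn_closed hD).
have tD' K L : vf K -> vf L -> tangent A p (D' K L p).
  by move=> vK vL; apply/tn/(conn_closed hD').
pose s K L Q := g p (D K L p) (Q p) - g p (D' K L p) (Q p).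
have sC K L Q : vf K -> vf L -> vf Q -> s K L Q = s L K Q.
  move=> vK vL vQ; have := conn_torsion hD vK vL Vp.
  rewrite (conn_torsion hD' vK vL Vp) => /(congr1 (fun u => g p u (Q p))).
  rewrite /= !(metricBl Vp); auto.
  by move=> E; apply/eqP; rewrite -subr_eq0 -(subrr (g p (D K L p) (Q p) - g p (D L K p) (Q p))) -{2}E /s; apply/eqP; ring.
have e K L Q : vf K -> vf L -> vf Q ->
    s K L Q + s K Q L = 2%:R * (b K p * g p (L p) (Q p)).
  move=> vK vL vQ; have := hb K L Q p vK vL vQ Vp.
  rewrite (hb' K L Q p vK vL vQ Vp) mul0r mulr0 subr0.
  rewrite !(metricC (tn _ vL)); auto.
  move=> /eqP; rewrite -subr_eq0 => /eqP E; apply/eqP; rewrite -subr_eq0; apply/eqP.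
  rewrite -[RHS]oppr0 -[in RHS]E /s; ring.
have two0 : (2%:R : R[i]) != 0 by rewrite pnatr_eq0.
apply: (mulfI two0); rewrite -/(s X Y Z).
have -> : 2%:R * s X Y Z = (s X Y Z + s X Z Y) + (s Y X Z + s Y Z X) - (s Z X Y + s Z Y X).
  by rewrite (sC Y X Z) // (sC Z X Y) // (sC Z Y X) //; ring.
rewrite !e //; ring.
Qed.

End Metric.

(** * The Ricci tensor of the characteristic connection *)

Section RicciIdentity.
Context {R : realType} {M : topologicalType} (A : set (chart R M)).
Hypothesis hM : smooth_manifold A.
Variable V : set M.
Hypothesis oV : open V.
Hypothesis tangent_lin : forall p, V p -> forall (a : R[i]) u v,
  tangent A p u -> tangent A p v -> tangent A p (a *: u + v).
Local Notation vf := (vfield_on A V).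
Local Notation sm := (smooth_on A V).
Variables (S : vfield R M -> Prop) (D : vfield R M -> vfield R M -> vfield R M).
Hypotheses (hS : field_module A V S) (hD : torsion_free_connection_on A V S D).
Implicit Types (W X Y Z : vfield R M) (f : M -> R[i]).

(** Tensoriality is expressed on fields of S rather than on vectors at a point, because D and the
    Ricci tensor built from it take fields as arguments. *)
Definition bilinear_tensor (T : vfield R M -> vfield R M -> M -> R[i]) : Prop :=
  [/\ forall Y Z, S Y -> S Z -> sm (T Y Z),
      forall Y Y' Z Z' p, S Y -> S Z -> (forall q, V q -> Y q = Y' q) ->
        (forall q, V q -> Z q = Z' q) -> V p -> T Y Z p = T Y' Z' p,
      forall f Y Y' Z p, sm f -> S Y -> S Y' -> S Z -> V p ->
        T (fun q => f q *: Y q + Y' q) Z p = f p * T Y Z p + T Y' Z p &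
      forall f Y Z Z' p, sm f -> S Y -> S Z -> S Z' -> V p ->
        T Y (fun q => f q *: Z q + Z' q) p = f p * T Y Z p + T Y Z' p].

(** The terms with one derivative on T and one on an argument cancel by symmetry. What remains is
    the commutator of the derivatives of the function T(Y, Z), absorbed by zero torsion, and the
    curvature acting on T as a derivation. *)
Lemma ricci_identity T W X Y Z p : bilinear_tensor T ->
  S W -> S X -> S Y -> S Z -> V p ->
  cov2 D T W X Y Z p - cov2 D T X W Y Z p =
  - T (curvature A D W X Y) Z p - T Y (curvature A D W X Z) p.
Proof.
move=> [Ts Te Tl Tr] SW SX SY SZ Vp.
have cl := conn_closed hD; have SL := lie_closed hM oV hS hD.
have sB := modB hM oV hS.
have TBl Y1 Y2 Z0 : S Y1 -> S Y2 -> S Z0 ->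
    T (fun q => Y1 q - Y2 q) Z0 p = T Y1 Z0 p - T Y2 Z0 p.
  move=> S1 S2 S0; rewrite (Te _ (fun q => (-1 : R[i]) *: Y2 q + Y1 q) _ Z0) //; last 2 first.
  - exact: sB.
  - by move=> q _; rewrite scaleN1r addrC.
  by rewrite (Tl (fun=> -1)) ?mulN1r 1?addrC //; exact: smooth_on_cst.
have TBr Y0 Z1 Z2 : S Y0 -> S Z1 -> S Z2 ->
    T Y0 (fun q => Z1 q - Z2 q) p = T Y0 Z1 p - T Y0 Z2 p.
  move=> S0 S1 S2; rewrite (Te _ Y0 _ (fun q => (-1 : R[i]) *: Z2 q + Z1 q)) //; last 2 first.
  - exact: sB.
  - by move=> q _; rewrite scaleN1r addrC.
  by rewrite (Tr (fun=> -1)) ?mulN1r 1?addrC //; exact: smooth_on_cst.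
have DL Q q : S Q -> V q -> D (lie A W X) Q q = D (D W X) Q q - D (D X W) Q q.
  move=> SQ Vq; rewrite -(connBl hM oV hS hD) //; [|exact: cl|exact: cl].
  apply: (conn_extl hS hD) => //; first exact: SL.
  by move=> r Vr; rewrite (conn_torsion hD).
have TLl : T (D (lie A W X) Y) Z p = T (D (D W X) Y) Z p - T (D (D X W) Y) Z p.
  rewrite -TBl //; try by [apply: (cl); [exact: cl|]].
  apply: Te => //; first by apply: (cl) => //; exact: SL.
  by move=> q Vq; exact: DL.
have TLr : T Y (D (lie A W X) Z) p = T Y (D (D W X) Z) p - T Y (D (D X W) Z) p.
  rewrite -TBr //; try by [apply: (cl); [exact: cl|]].
  apply: Te => //; first by apply: (cl) => //; exact: SL.
  by move=> q Vq; exact: DL.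
have Tcl : T (curvature A D W X Y) Z p =
    T (D W (D X Y)) Z p - T (D X (D W Y)) Z p - T (D (lie A W X) Y) Z p.
  rewrite /curvature TBl ?TBl; auto.
have Tcr : T Y (curvature A D W X Z) p =
    T Y (D W (D X Z)) p - T Y (D X (D W Z)) p - T Y (D (lie A W X) Z) p.
  rewrite /curvature TBr ?TBr; auto.
have actB X0 W0 : S X0 -> S W0 -> (W0 p (cov1 D T X0 Y Z) : R[i]) =
    W0 p (fun q => X0 q (T Y Z)) - W0 p (T (D X0 Y) Z) - W0 p (T Y (D X0 Z)).
  move=> S0 S0'; have vX0 := mod_vf hS S0; have vW0 := mod_vf hS S0'.
  have s1 := vf_smooth oV vX0 (Ts _ _ SY SZ).
  have s2 := Ts _ _ (cl _ _ S0 SY) SZ.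
  have s3 := Ts _ _ SY (cl _ _ S0 SZ).
  rewrite -(vf_actB hM oV vW0 s1 s2 Vp).
  by rewrite -(vf_actB hM oV vW0 (smooth_onB hM oV s1 s2) s3 Vp).
(* The derivative along D_W X - D_X W comes from the two [cov1] terms differentiating the direction;
   by zero torsion it equals the commutator of W and X on T(Y, Z). *)
have LE : ((D W X p - D X W p) (T Y Z) : R[i]) =
    (W p (fun q => X q (T Y Z)) : R[i]) - X p (fun q => W q (T Y Z)).
  by rewrite -(conn_torsion hD SW SX Vp) (lieE oV _ _ (Ts _ _ SY SZ) Vp).
rewrite !tvecE in LE.
rewrite /cov2 !actB // Tcl Tcr TLl TLr /cov1.
move/eqP: LE; rewrite -subr_eq0 => /eqP LE.
by apply/eqP; rewrite -subr_eq0; apply/eqP; rewrite -[RHS]oppr0 -[in RHS]LE; ring.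
Qed.

End RicciIdentity.

Section RicciSymmetric.
Context {R : realType} {M : topologicalType} (A : set (chart R M)).
Hypothesis hM : smooth_manifold A.
Variable V : set M.
Hypothesis oV : open V.
Hypothesis tangent_lin : forall p, V p -> forall (a : R[i]) u v,
  tangent A p u -> tangent A p v -> tangent A p (a *: u + v).
Local Notation vf := (vfield_on A V).
Local Notation sm := (smooth_on A V).
Variable g : M -> tvec R M -> tvec R M -> R[i].
Hypothesis hg : complex_metric A g.
Variables (S : vfield R M -> Prop) (D : vfield R M -> vfield R M -> vfield R M).
Hypotheses (hS : field_module A V S) (hD : torsion_free_connection_on A V S D).
Variables f h : 'I_2 -> vfield R M.
Hypotheses (Sf : forall i, S (f i)) (vh : forall i, vf (h i)).
Hypothesis dual_fh : forall p i j, V p -> g p (f i p) (h j p) = (i == j)%:R.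
Hypothesis span_f : forall X p, S X -> V p -> exists a, X p = lincomb (f ^~ p) a.
Implicit Types (X Y Z : vfield R M).

Let i0 : 'I_2 := ord0.
Let i1 : 'I_2 := lift ord0 ord0.

Lemma sum2 (F : 'I_2 -> R[i]) : \sum_(i < 2) F i = F i0 + F i1.
Proof. by rewrite !big_ord_recl big_ord0 addr0. Qed.

Lemma lincomb2 (e : 'I_2 -> tvec R M) a :
  lincomb e a = a 0 i0 *: e i0 + a 0 i1 *: e i1.
Proof. by rewrite /lincomb !big_ord_recl big_ord0 addr0. Qed.

Lemma lincomb_dual a i p : V p -> g p (lincomb (f ^~ p) a) (h i p) = a 0 i.
Proof.
move=> Vp; have tf j := vf_tangent (mod_vf hS (Sf j)) Vp.
have th j := vf_tangent (vh j) Vp; have tZ := @tangent_closedZ _ _ A hM V tangent_lin p Vp.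
rewrite lincomb2 (metricDl hg) ?(metricZl hM hg); auto; rewrite !dual_fh //.
case: i => [[|[|//]] /= i2]; rewrite /= ?mulr1 ?mulr0 ?addr0 ?add0r;
  congr (a 0 _); exact: val_inj.
Qed.

(** Coordinates picked by [xget] become products with the dual fields, which makes them independent
    of the choice and smooth in p. *)
Lemma component_dual X i p : S X -> V p -> component f X i p = g p (X p) (h i p).
Proof.
move=> SX Vp; rewrite /component; case: xgetP => [a _ /= Xa|nX].
  by rewrite Xa lincomb_dual.
by have [a Xa] := span_f SX Vp; case: (nX a).
Qed.

Lemma section_expand X p : S X -> V p ->
  X p = g p (X p) (h i0 p) *: f i0 p + g p (X p) (h i1 p) *: f i1 p.
Proof.
move=> SX Vp; have [a Xa] := span_f SX Vp.
by rewrite {2 3}Xa !lincomb_dual // Xa lincomb2.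
Qed.

Local Notation Ric := (ricci_partial A D f).
Local Notation Rm := (curvature A D).

Lemma ricci_partialE Y Z p : S Y -> S Z -> V p ->
  Ric Y Z p = g p (Rm (f i0) Z Y p) (h i0 p) + g p (Rm (f i1) Z Y p) (h i1 p).
Proof.
move=> SY SZ Vp; rewrite /ricci_partial sum2.
by rewrite !component_dual //; exact: (curvature_closed hM oV hS hD).
Qed.

Lemma ricci_bilinear : bilinear_tensor A V S Ric.
Proof.
have vS := mod_vf hS; have cl := curvature_closed hM oV hS hD.
have tS X p (SX : S X) (Vp : V p) := vf_tangent (vS X SX) Vp.
have th j p (Vp : V p) := vf_tangent (vh j) Vp.
have tZ := @tangent_closedZ _ _ A hM V tangent_lin.
split=> [Y Z SY SZ|Y Y' Z Z' p SY SZ YY ZZ Vp|k Y Y' Z p sk SY SY' SZ Vp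
        |k Y Z Z' p sk SY SZ SZ' Vp].
- apply: (smooth_on_ext hM oV) => [p Vp|].
    by rewrite ricci_partialE.
  apply: (smooth_onD hM oV); apply: (metric_smooth oV hg) => //; apply/vS; exact: cl.
- have [SY' SZ'] := (mod_ext hS SY YY, mod_ext hS SZ ZZ).
  rewrite !ricci_partialE //; congr (g p _ _ + g p _ _);
    exact: (curvature_ext hM oV hS hD).
- have SL := mod_lin hS sk SY SY'.
  rewrite !ricci_partialE // !(curvature_linr hM oV hS hD) //.
  have tR X1 X2 X3 : S X1 -> S X2 -> S X3 -> tangent A p (Rm X1 X2 X3 p).
    by move=> S1 S2 S3; exact: tS (cl _ _ _ S1 S2 S3) Vp.
  have lin u v w : tangent A p u -> tangent A p v -> tangent A p w ->
      g p (k p *: u + v) w = k p * g p u w + g p v w.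
    by move=> tu tv tw; rewrite (metricDl hg) ?(metricZl hM hg) //; exact: tZ.
  rewrite !lin; auto; ring.
- have SL := mod_lin hS sk SZ SZ'.
  rewrite !ricci_partialE // !(curvature_linm hM oV hS hD) //.
  have tR X1 X2 X3 : S X1 -> S X2 -> S X3 -> tangent A p (Rm X1 X2 X3 p).
    by move=> S1 S2 S3; exact: tS (cl _ _ _ S1 S2 S3) Vp.
  have lin u v w : tangent A p u -> tangent A p v -> tangent A p w ->
      g p (k p *: u + v) w = k p * g p u w + g p v w.
    by move=> tu tv tw; rewrite (metricDl hg) ?(metricZl hM hg) //; exact: tZ.
  rewrite !lin; auto; ring.
Qed.

(** Coordinate form of S^2 + det S = 0: its two diagonal entries, read off from the components (a,
    b) = (0, 1) and (1, 0) of the Ricci identity, suffice for the trace argument. *)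
Lemma trace_curvature_eq0 p : V p ->
  (forall (c d a b : 'I_2) p, V p ->
    (cov2 D Ric (f c) (f d) (f a) (f b) p
     - cov2 D Ric (f d) (f c) (f a) (f b) p) / 2%:R = 0) ->
  g p (Rm (f i0) (f i1) (f i0) p) (h i0 p)
  + g p (Rm (f i0) (f i1) (f i1) p) (h i1 p) = 0.
Proof.
move=> Vp hRic; have [Ts Te Tl Tr] := ricci_bilinear.
have cl := curvature_closed hM oV hS hD.
have two0 : (2%:R : R[i]) != 0 by rewrite pnatr_eq0.
have th j := vf_tangent (vh j) Vp.
have sG Y j : S Y -> sm (fun q => g q (Y q) (h j q)).
  by move=> SY; apply: (metric_smooth oV hg) => //; exact: (mod_vf hS).
have idE a b : Ric (Rm (f i0) (f i1) (f a)) (f b) p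
             + Ric (f a) (Rm (f i0) (f i1) (f b)) p = 0.
  have := hRic i0 i1 a b p Vp => /eqP; rewrite mulf_eq0 invr_eq0 (negPf two0) orbF.
  rewrite (ricci_identity hM oV hS hD ricci_bilinear) // -opprD oppr_eq0.
  by move/eqP.
have expl Y Z : S Y -> S Z -> Ric Y Z p =
    g p (Y p) (h i0 p) * Ric (f i0) Z p + g p (Y p) (h i1 p) * Ric (f i1) Z p.
  move=> SY SZ; pose c j q := g q (Y q) (h j q).
  rewrite (Te Y (fun q => c i0 q *: f i0 q + (c i1 q *: f i1 q + 0)) Z Z) //; last first.
    by move=> q Vq; rewrite addr0; exact: section_expand.
  have S1 := mod_lin hS (sG Y i1 SY) (Sf i1) (mod0 hS).
  rewrite (Tl (c i0)) //; last exact: sG.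
  (* Linearity is available only for sums f Y + Y', so the last summand 0 is written as - f_1 + f_1,
     on which the tensor gives - T + T = 0. *)
  congr (_ + _); rewrite (Te _ (fun q => c i1 q *: f i1 q + (-1 *: f i1 q + f i1 q)) Z Z) //; last first.
    by move=> q Vq; rewrite scaleN1r addNr.
  have sc := smooth_on_cst hM (-1 : R[i]) oV.
  rewrite (Tl (c i1)) //; [|exact: sG|exact: (mod_lin hS sc)].
  by rewrite (Tl (fun=> -1)) // mulN1r addNr addr0.
have expr Y Z : S Y -> S Z -> Ric Y Z p =
    g p (Z p) (h i0 p) * Ric Y (f i0) p + g p (Z p) (h i1 p) * Ric Y (f i1) p.
  move=> SY SZ; pose c j q := g q (Z q) (h j q).
  rewrite (Te Y Y Z (fun q => c i0 q *: f i0 q + (c i1 q *: f i1 q + 0))) //; last first.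
    by move=> q Vq; rewrite addr0; exact: section_expand.
  have S1 := mod_lin hS (sG Z i1 SZ) (Sf i1) (mod0 hS).
  rewrite (Tr (c i0)) //; last exact: sG.
  congr (_ + _); rewrite (Te Y Y _ (fun q => c i1 q *: f i1 q + (-1 *: f i1 q + f i1 q))) //; last first.
    by move=> q Vq; rewrite scaleN1r addNr.
  have sc := smooth_on_cst hM (-1 : R[i]) oV.
  rewrite (Tr (c i1)) //; [|exact: sG|exact: (mod_lin hS sc)].
  by rewrite (Tr (fun=> -1)) // mulN1r addNr addr0.
have RN X Y Z : S X -> S Y -> S Z -> Rm X Y Z p = - Rm Y X Z p.
  by move=> SX SY SZ; apply: (curvatureN hM oV hS hD).
have diag X Z j : S X -> S Z -> g p (Rm X X Z p) (h j p) = 0.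
  move=> SX SZ; have t1 := vf_tangent (mod_vf hS (cl _ _ _ SX SX SZ)) Vp.
  have E := RN X X Z SX SX SZ; have := metricNl hM hg t1 (th j).
  rewrite -E => /eqP; by rewrite -addr_eq0 -mulr2n mulrn_eq0 /= => /eqP.
(* Since R(f_i, f_i) = 0, a single term of each trace survives; the sign comes from R(f_1, f_0) = -
   R(f_0, f_1). *)
have R0 a : Ric (f a) (f i0) p = - g p (Rm (f i0) (f i1) (f a) p) (h i1 p).
  rewrite ricci_partialE // diag // add0r RN // (metricNl hM hg) //.
  by apply: vf_tangent Vp; apply: (mod_vf hS); exact: cl.
have R1 a : Ric (f a) (f i1) p = g p (Rm (f i0) (f i1) (f a) p) (h i0 p).
  by rewrite ricci_partialE // diag // addr0.
have := idE i0 i1; have := idE i1 i0.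
rewrite !(expl (Rm _ _ _)) //; do ?[exact: cl].
rewrite !(fun Y b => expr Y (Rm (f i0) (f i1) (f b))) //; do ?[exact: cl].
rewrite !R0 !R1.
set a := g p _ _; set b := g p _ _; set c := g p _ _; set d := g p _ _.
(* The difference of the two identities is tr(S^2) + 2 det S, which is the square of tr S. *)
move=> E1 E2; apply/eqP; rewrite -sqrf_eq0; apply/eqP.
by rewrite -[RHS](subrr 0) -{1}E2 -E1; ring.
Qed.

End RicciSymmetric.

(** * Weyl and Levi-Civita curvatures along N *)

Section NullFrame.
Context {R : realType} {M : topologicalType} (A : set (chart R M)).
Hypothesis hM : smooth_manifold A.
Variable V : set M.
Hypothesis oV : open V.
Hypothesis tangent_lin : forall p, V p -> forall (a : R[i]) u v,
  tangent A p u -> tangent A p v -> tangent A p (a *: u + v).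
Local Notation vf := (vfield_on A V).
Local Notation sm := (smooth_on A V).
Variable g : M -> tvec R M -> tvec R M -> R[i].
Hypothesis hg : complex_metric A g.
Variables (S : vfield R M -> Prop) (nabla W : vfield R M -> vfield R M -> vfield R M).
Variable b : vfield R M -> M -> R[i].
Hypothesis hS : field_module A V S.
Hypotheses (hn : torsion_free_connection_on A V vf nabla)
  (hW : torsion_free_connection_on A V vf W).
Hypotheses (cn : weyl_compatible A V g nabla (fun _ _ => 0))
  (cW : weyl_compatible A V g W b).
Hypothesis b_lie : forall X Y p, vf X -> vf Y -> V p ->
  b (lie A X Y) p = b (W X Y) p - b (W Y X) p.
Hypothesis W_S : forall Y X, vf Y -> S X -> S (W Y X).
Hypothesis S_null : forall X Y p, S X -> S Y -> V p -> g p (X p) (Y p) = 0.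
Variables f h : 'I_2 -> vfield R M.
Hypotheses (Sf : forall i, S (f i)) (vh : forall i, vf (h i)).
Hypothesis dual_fh : forall p i j, V p -> g p (f i p) (h j p) = (i == j)%:R.
Hypothesis h_null : forall p i j, V p -> g p (h i p) (h j p) = 0.
Hypothesis nondeg : forall p u, V p -> tangent A p u ->
  (forall i, g p u (f i p) = 0) -> (forall i, g p u (h i p) = 0) -> u = 0.
Implicit Types (X Y Z T : vfield R M).

Let i0 : 'I_2 := ord0.
Let i1 : 'I_2 := lift ord0 ord0.
Let vS X : S X -> vf X := mod_vf hS (X := X).
Let tS X p (SX : S X) (Vp : V p) : tangent A p (X p) := vf_tangent (vS SX) Vp.
Let vm : field_module A V vf := vf_module hM tangent_lin.
Let tW X Y p (vX : vf X) (vY : vf Y) (Vp : V p) : tangent A p (W X Y p) :=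
  vf_tangent (conn_closed hW vX vY) Vp.
Let tn X Y p (vX : vf X) (vY : vf Y) (Vp : V p) : tangent A p (nabla X Y p) :=
  vf_tangent (conn_closed hn vX vY) Vp.

(** The general difference of the two connections has a further term proportional to g(X, Y), which
    vanishes because N is null. What is left is a projective change of connection. *)
Lemma nabla_eq X Y p : S X -> S Y -> V p ->
  nabla X Y p = W X Y p - (b X p *: Y p + b Y p *: X p).
Proof.
move=> SX SY Vp; have [vX vY] := (vS SX, vS SY).
have [tX tY] := (tS SX Vp, tS SY Vp).
have [tnXY tWXY] := (tn vX vY Vp, tW vX vY Vp).
have tZ := @tangent_closedZ _ _ A hM V tangent_lin p Vp.
have tB := @tangent_closedB _ _ A hM V tangent_lin p Vp.
have tD := @tangent_closedD _ _ A V tangent_lin p Vp.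
have tc : tangent A p (b X p *: Y p + b Y p *: X p) by apply: tD; exact: tZ.
have E Z : vf Z ->
  g p (W X Y p - nabla X Y p - (b X p *: Y p + b Y p *: X p)) (Z p) = 0.
  move=> vZ; have tz := vf_tangent vZ Vp.
  have := weyl_compatible_diff hM tangent_lin hg hW cW hn cn vX vY vZ Vp.
  rewrite (S_null SX SY Vp) mulr0 subr0 => E.
  rewrite !(metricBl hM tangent_lin hg Vp) ?(metricDl hg) ?(metricZl hM hg) //; auto.
  by rewrite E ?(metricZl hM hg) ?subrr //.
apply/esym/eqP; rewrite -subr_eq0 addrAC; apply/eqP.
by apply: (nondeg Vp); auto => i; apply: E => //; exact: vS.
Qed.

Lemma W_connection_on : torsion_free_connection_on A V S W.
Proof.
case: hW => cl ext linl linr tor; split.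
- by move=> X Y SX SY; apply: W_S => //; exact: vS.
- by move=> X X' Y Y' SX SX' SY SY'; apply: ext; exact: vS.
- by move=> c X X' Y sc SX SX' SY p Vp; apply: linl => //; exact: vS.
- by move=> c X Y Y' sc SX SY SY' p Vp; apply: linr => //; exact: vS.
- by move=> X Y SX SY p Vp; apply: tor => //; exact: vS.
Qed.

Lemma nabla_S X Y : S X -> S Y -> S (nabla X Y).
Proof.
move=> SX SY; have [sb _] := cW.
have SXY := W_S (vS SX) SY.
have SZ := modZ hS (sb _ (vS SX)) SY; have SZ' := modZ hS (sb _ (vS SY)) SX.
apply: (mod_ext hS (modB hM oV hS SXY (modD hM oV hS SZ SZ'))) => p Vp.
by rewrite nabla_eq.
Qed.

Lemma nabla_connection_on : torsion_free_connection_on A V S nabla.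
Proof.
case: hn => cl ext linl linr tor; split.
- exact: nabla_S.
- by move=> X X' Y Y' SX SX' SY SY'; apply: ext; exact: vS.
- by move=> c X X' Y sc SX SX' SY p Vp; apply: linl => //; exact: vS.
- by move=> c X Y Y' sc SX SY SY' p Vp; apply: linr => //; exact: vS.
- by move=> X Y SX SY p Vp; apply: tor => //; exact: vS.
Qed.

(** This is (W_X b)(Z) + b(X) b(Z), the tensor by which curvature varies under a projective change
    of connection; P(X, Z) - P(Z, X) = db(X, Z). *)
Let P X Z p : R[i] := (X p (b Z) : R[i]) - b (W X Z) p + b X p * b Z p.

Lemma curvature_nabla X Y Z p : S X -> S Y -> S Z -> V p ->
  curvature A nabla X Y Z p = curvature A W X Y Z p
    - ext_deriv A b X Y p *: Z p + P Y Z p *: X p - P X Z p *: Y p.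
Proof.
move=> SX SY SZ Vp; have [sb _] := cW.
have hnS := nabla_connection_on; have hWS := W_connection_on.
have cl := conn_closed hWS; have cln := conn_closed hnS.
have SL := lie_closed hM oV hS hWS SX SY.
have SsZ K Q : S K -> S Q -> S (fun q => b K q *: Q q).
  by move=> SK SQ; apply: (modZ hS) => //; apply: sb; exact: vS.
have SsD := modD hM oV hS; have SsB := modB hM oV hS.
have nn K L Q : S K -> S L -> S Q -> nabla K (nabla L Q) p =
    (W K (W L Q) p - (b K p *: W L Q p + b (W L Q) p *: K p))
    - ((K p (b L) *: Q p + b L p *: (W K Q p - (b K p *: Q p + b Q p *: K p)))
      + (K p (b Q) *: L p + b Q p *: (W K L p - (b K p *: L p + b L p *: K p)))).
  move=> SK SL' SQ; have [S1 S2] := (SsZ _ _ SL' SQ, SsZ _ _ SQ SL').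
  have -> : nabla K (nabla L Q) p = nabla K (fun q => W L Q q -
      (b L q *: Q q + b Q q *: L q)) p.
    apply: (conn_extr hS hnS) => //; first exact: cln.
    by move=> q Vq; rewrite nabla_eq.
  rewrite (connBr hM oV hS hnS SK (cl _ _ SL' SQ) (SsD _ _ S1 S2) Vp).
  rewrite (connDr hM oV hS hnS SK S1 S2 Vp).
  rewrite (connZr hM oV hS hnS (sb _ (vS SL')) SK SQ Vp).
  rewrite (connZr hM oV hS hnS (sb _ (vS SQ)) SK SL' Vp).
  by rewrite !nabla_eq //; exact: cl.
rewrite /curvature !nn // (nabla_eq SL SZ Vp).
rewrite (b_lie (vS SX) (vS SY) Vp) (conn_torsion hWS SX SY Vp) /ext_deriv.
rewrite (b_lie (vS SX) (vS SY) Vp) /P.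
by apply: tvecP => k; rewrite !tvecE; ring.
Qed.

(** In the Bianchi sum of f_0, f_1, h_i the two other terms are curvatures applied to sections of N.
    As W preserves N in every direction, h_i included, they lie in N and are orthogonal to f_i.
    Metricity up to scale then leaves 2 db on each diagonal entry. *)
Lemma curvature_W_dual i p : V p ->
  g p (curvature A W (f i0) (f i1) (f i) p) (h i p) =
  2%:R * ext_deriv A b (f i0) (f i1) p.
Proof.
move=> Vp; have clW := curvature_closed hM oV vm hW.
have vf0 := vS (Sf i0); have vf1 := vS (Sf i1); have vfi := vS (Sf i).
have RS X Y Z : vf X -> vf Y -> S Z -> S (curvature A W X Y Z).
  move=> vX vY SZ; have SB := modB hM oV hS; apply: (SB); last first.
    by apply: W_S => //; exact: (lie_closed hM oV vm hW).
  by apply: (SB); apply: W_S => //; exact: W_S.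
have bian := first_bianchi hM oV vm hW vf0 vf1 (vh i) Vp (lie_jacobi hM oV vf0 vf1 (vh i) Vp).
have t X Y Z : vf X -> vf Y -> vf Z -> tangent A p (curvature A W X Y Z p).
  by move=> vX vY vZ; exact: vf_tangent (clW _ _ _ vX vY vZ) Vp.
have tfi := tS (Sf i) Vp.
have E : g p (curvature A W (f i0) (f i1) (h i) p) (f i p) = 0.
  have t1 := t _ _ _ vf0 vf1 (vh i); have t2 := t _ _ _ vf1 (vh i) vf0.
  have t3 := t _ _ _ (vh i) vf0 vf1.
  have := congr1 (fun u => g p u (f i p)) bian; rewrite /= (metric0l hM hg tfi).
  rewrite (metricDl hg (tangent_closedD tangent_lin Vp t1 t2) t3 tfi) (metricDl hg t1 t2 tfi).
  rewrite (S_null (RS _ _ _ vf1 (vh i) (Sf i0)) (Sf i) Vp).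
  by rewrite (S_null (RS _ _ _ (vh i) vf0 (Sf i1)) (Sf i) Vp) !addr0.
have := curvature_metric hM oV tangent_lin hg hW cW vf0 vf1 vfi (vh i) Vp.
rewrite (metricC hg tfi); auto.
by rewrite E addr0 dual_fh // eqxx mulr1.
Qed.

Lemma trace_curvature_nabla p : V p ->
  g p (curvature A W (f i0) (f i1) (f i0) p) (h i0 p)
  + g p (curvature A W (f i0) (f i1) (f i1) p) (h i1 p) = 0 ->
  g p (curvature A nabla (f i0) (f i1) (f i0) p) (h i0 p)
  + g p (curvature A nabla (f i0) (f i1) (f i1) p) (h i1 p) = 0.
Proof.
move=> Vp tr0.
have d0 : ext_deriv A b (f i0) (f i1) p = 0.
  have four0 : (4%:R : R[i]) != 0 by rewrite pnatr_eq0.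
  apply: (mulfI four0); rewrite mulr0 -[RHS]tr0 !curvature_W_dual //; ring.
have hWS := W_connection_on.
have t i := vf_tangent (vS (curvature_closed hM oV hS hWS (Sf i0) (Sf i1) (Sf i))) Vp.
have tf i := tS (Sf i) Vp; have th i := vf_tangent (vh i) Vp.
have tZ := @tangent_closedZ _ _ A hM V tangent_lin p Vp.
have tB := @tangent_closedB _ _ A hM V tangent_lin p Vp.
have tD := @tangent_closedD _ _ A V tangent_lin p Vp.
have comb (u v w z : tvec R M) (a1 a2 a3 : R[i]) i : tangent A p u -> tangent A p v ->
    tangent A p w -> tangent A p z ->
    g p (u - a1 *: v + a2 *: w - a3 *: z) (h i p) =
    g p u (h i p) - a1 * g p v (h i p) + a2 * g p w (h i p) - a3 * g p z (h i p).
  move=> tu tv tw tz; rewrite (metricBl hM tangent_lin hg Vp); auto.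
  rewrite (metricDl hg); auto; rewrite (metricBl hM tangent_lin hg Vp); auto.
  by rewrite !(metricZl hM hg).
rewrite !curvature_nabla // !comb // !dual_fh // /=.
move: d0 tr0; rewrite /P /ext_deriv (b_lie (vS (Sf i0)) (vS (Sf i1)) Vp) => d0 tr0.
(* Origin of -3: the term - db Z contributes -2 db to the trace in rank 2, and P(f_1, f_0) - P(f_0,
   f_1) contributes - db. *)
rewrite -[RHS]tr0 -[RHS]addr0 -[X in _ = _ + X](mulr0 (-3%:R)) -[X in _ = _ + _ * X]d0.
by ring.
Qed.

Lemma curvature_nabla_null i j p : V p ->
  g p (f j p) (curvature A nabla (f i0) (f i1) (f i) p) = 0.
Proof.
move=> Vp; apply: S_null => //.
exact: (curvature_closed hM oV hS nabla_connection_on).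
Qed.

(** The nested form ending in 0 matches the shape f X + X' of the linearity clauses, so that they
    can be applied one summand at a time. *)
Lemma vf_expand X p : vf X -> V p -> X p =
  g p (X p) (h i0 p) *: f i0 p + (g p (X p) (h i1 p) *: f i1 p +
  (g p (X p) (f i0 p) *: h i0 p + (g p (X p) (f i1 p) *: h i1 p + 0))).
Proof.
move=> vX Vp; have tX := vf_tangent vX Vp.
have tf i := tS (Sf i) Vp; have th i := vf_tangent (vh i) Vp.
have tZ := @tangent_closedZ _ _ A hM V tangent_lin p Vp.
have tB := @tangent_closedB _ _ A hM V tangent_lin p Vp.
have tD := @tangent_closedD _ _ A V tangent_lin p Vp.
rewrite addr0; apply/eqP; rewrite -subr_eq0; apply/eqP.
have lin a1 a2 a3 a4 w : tangent A p w ->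
    g p (X p - (a1 *: f i0 p + (a2 *: f i1 p + (a3 *: h i0 p + a4 *: h i1 p)))) w =
    g p (X p) w - (a1 * g p (f i0 p) w + (a2 * g p (f i1 p) w
      + (a3 * g p (h i0 p) w + a4 * g p (h i1 p) w))).
  move=> tw; rewrite (metricBl hM tangent_lin hg Vp); auto 7.
  by rewrite !(metricDl hg) ?(metricZl hM hg) //; auto 7.
have ff i j := S_null (Sf i) (Sf j) Vp.
have hf i j : g p (h i p) (f j p) = (j == i)%:R by rewrite (metricC hg) // dual_fh.
have ii (i : 'I_2) : i = i0 \/ i = i1.
  by case: i => [[|[|//]] ?]; [left|right]; exact: val_inj.
apply: (nondeg Vp); first by auto 7.
  move=> i; rewrite lin // !ff !hf.
  by case: (ii i) => -> /=; rewrite ?mulr1 ?mulr0 ?addr0 ?add0r subrr.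
move=> i; rewrite lin // !h_null // !dual_fh //.
by case: (ii i) => -> /=; rewrite ?mulr1 ?mulr0 ?addr0 ?add0r subrr.
Qed.

(** Fields over V expand in the frame (f, h) with smooth coefficients, so a function-linear [Phi]
    depends only on the coefficients at q; as the frame is defined on all of V, no cut-off function
    enters. *)
Lemma tensor_at (Phi : vfield R M -> tvec R M) X X' q : V q ->
  (forall X X', vf X -> (forall p, V p -> X p = X' p) -> Phi X = Phi X') ->
  (forall c X X', sm c -> vf X -> vf X' ->
     Phi (fun p => c p *: X p + X' p) = c q *: Phi X + Phi X') ->
  vf X -> vf X' -> X q = X' q -> Phi X = Phi X'.
Proof.
move=> Vq ext lin.
suff E Y : vf Y -> Phi Y = g q (Y q) (h i0 q) *: Phi (f i0) +
    (g q (Y q) (h i1 q) *: Phi (f i1) + (g q (Y q) (f i0 q) *: Phi (h i0) +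
    (g q (Y q) (f i1 q) *: Phi (h i1) + Phi (fun=> 0)))).
  by move=> vX vX' XX'; rewrite (E _ vX) (E _ vX') XX'.
move=> vY; have sG Z : vf Z -> sm (fun p => g p (Y p) (Z p)).
  by move=> vZ; exact: (metric_smooth oV hg).
have vfi i := vS (Sf i); have v0 := vf0 hM V.
have s1 := sG _ (vh i0); have s2 := sG _ (vh i1).
have s3 := sG _ (vfi i0); have s4 := sG _ (vfi i1).
have L := mod_lin vm.
have v4 := L _ _ _ s4 (vh i1) v0; have v3 := L _ _ _ s3 (vh i0) v4.
have v2 := L _ _ _ s2 (vfi i1) v3.
rewrite (ext Y _ vY (fun p Vp => vf_expand vY Vp)).
rewrite (lin _ _ _ s1 (vfi i0) v2) (lin _ _ _ s2 (vfi i1) v3).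
by rewrite (lin _ _ _ s3 (vh i0) v4) (lin _ _ _ s4 (vh i1) v0).
Qed.

(** Needed because the frame of N coincides with m and k at the single point q; the three arguments
    are exchanged one after the other. *)
Lemma curvature_at X X' Y Y' Z Z' q : V q ->
  vf X -> vf X' -> vf Y -> vf Y' -> vf Z -> vf Z' ->
  X q = X' q -> Y q = Y' q -> Z q = Z' q ->
  curvature A nabla X Y Z q = curvature A nabla X' Y' Z' q.
Proof.
move=> Vq vX vX' vY vY' vZ vZ' XX YY ZZ.
have ext := curvature_ext hM oV vm hn.
transitivity (curvature A nabla X' Y Z q).
  apply: (tensor_at (Phi := fun K => curvature A nabla K Y Z q) Vq) vX vX' XX.
    by move=> K K' vK KK; apply: ext.
  by move=> c K K' sc vK vK'; apply: (curvature_linl hM oV vm hn).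
transitivity (curvature A nabla X' Y' Z q).
  apply: (tensor_at (Phi := fun K => curvature A nabla X' K Z q) Vq) vY vY' YY.
    by move=> K K' vK KK; apply: ext.
  by move=> c K K' sc vK vK'; apply: (curvature_linm hM oV vm hn).
apply: (tensor_at (Phi := fun K => curvature A nabla X' Y' K q) Vq) vZ vZ' ZZ.
  by move=> K K' vK KK; apply: ext.
by move=> c K K' sc vK vK'; apply: (curvature_linr hM oV vm hn).
Qed.

End NullFrame.

(** * The scalars Psi_0 and Psi_1 as Riemann components in a null frame *)

Section WeylScalars.
Context {R : realType} {M : topologicalType} (A : set (chart R M)).
Hypothesis hM : smooth_manifold A.
Variable V : set M.
Hypothesis oV : open V.
Hypothesis tangent_lin : forall p, V p -> forall (a : R[i]) u v,
  tangent A p u -> tangent A p v -> tangent A p (a *: u + v).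
Local Notation vf := (vfield_on A V).
Variable g : M -> tvec R M -> tvec R M -> R[i].
Hypothesis hg : complex_metric A g.
Variable nabla : vfield R M -> vfield R M -> vfield R M.
Hypothesis hn : torsion_free_connection_on A V vf nabla.
Hypothesis cn : weyl_compatible A V g nabla (fun _ _ => 0).
Variables m p n k : vfield R M.
Hypotheses (vm : vf m) (vp : vf p) (vn : vf n) (vk : vf k).
Variable q : M.
Hypotheses (Vq : V q) (gramE : gram g (frame4 m p n k) q = null_gram).

Local Notation Rm := (curvature A nabla).
Local Notation e := (frame4 m p n k).

Lemma frame4_m : e (inord 0) = m.
Proof. by rewrite /frame4 (tnth_nth m) /= inordK. Qed.
Lemma frame4_p : e (inord 1) = p.
Proof. by rewrite /frame4 (tnth_nth m) /= inordK. Qed.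
Lemma frame4_n : e (inord 2) = n.
Proof. by rewrite /frame4 (tnth_nth m) /= inordK. Qed.
Lemma frame4_k : e (inord 3) = k.
Proof. by rewrite /frame4 (tnth_nth m) /= inordK. Qed.

Lemma null_gramE (a b : nat) : (a < 4)%N -> (b < 4)%N ->
  @null_gram R (inord a) (inord b) = ((a./2 == b./2) && (a != b))%:R.
Proof. by move=> a4 b4; rewrite mxE -val_eqE /= !inordK. Qed.

Lemma sum4 (U : nmodType) (F : 'I_4 -> U) :
  \sum_(i < 4) F i = F (inord 0) + F (inord 1) + F (inord 2) + F (inord 3).
Proof.
rewrite !big_ord_recr big_ord0 /= add0r.
by congr (F _ + F _ + F _ + F _); apply: val_inj; rewrite /= inordK.
Qed.

(** The Gram matrix is the permutation matrix exchanging m with p and n with k. It is therefore its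
    own inverse, which raises the indices in [ricci]. *)
Lemma null_gram_involutive : null_gram *m null_gram = 1%:M :> 'M[R[i]]_4.
Proof.
apply/matrixP => i j; rewrite mxE sum4.
have iE : i = inord i by rewrite inord_val.
have jE : j = inord j by rewrite inord_val.
rewrite iE jE !null_gramE ?ltn_ord // !mxE -val_eqE /= !inordK ?ltn_ord //.
case: i {iE} => [[|[|[|[|//]]]] i4]; case: j {jE} => [[|[|[|[|//]]]] j4];
  by rewrite /= ?mulr0 ?mulr1 ?addr0 ?add0r.
Qed.

Lemma invmx_null_gram : invmx null_gram = null_gram :> 'M[R[i]]_4.
Proof.
have [uG _] := mulmx1_unit null_gram_involutive.
by rewrite -[LHS]mulmx1 -null_gram_involutive mulKmx.
Qed.

Let tv X (vX : vf X) : tangent A q (X q) := vf_tangent vX Vq.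
Let vcurv X Y Z (vX : vf X) (vY : vf Y) (vZ : vf Z) : vf (Rm X Y Z) :=
  curvature_closed hM oV (vf_module hM tangent_lin) hn vX vY vZ.

Lemma curvature_antisym X Y Z T : vf X -> vf Y -> vf Z -> vf T ->
  g q (Z q) (Rm X Y T q) = - g q (T q) (Rm X Y Z q).
Proof.
move=> vX vY vZ vT.
have E := curvature_metric hM oV tangent_lin hg hn cn vX vY vZ vT Vq.
have d0 : ext_deriv A (fun _ _ => 0 : R[i]) X Y q = 0.
  rewrite /ext_deriv (vf_act_cst hM (0 : R[i]) vX Vq).
  by rewrite (vf_act_cst hM (0 : R[i]) vY Vq) !subrr.
move: E; rewrite d0 mulr0 mul0r (metricC hg (tv (vcurv vX vY vZ)) (tv vT)).
by move/eqP; rewrite addrC addr_eq0 => /eqP.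
Qed.

(** All products among m and k vanish, so every trace correction in the Weyl tensor drops out. *)
Lemma Psi0E : Psi0 A g nabla m p n k q = g q (m q) (Rm m k k q).
Proof.
rewrite /Psi0 /weyl gramE /idx_m /idx_k !null_gramE //= !mul0r !subrr addr0.
by rewrite !mul0r !mulr0 mul0r subr0 addr0 /riemann frame4_m frame4_k.
Qed.

(** Among the products entering C(m, k, n, k) only g(k, n) = 1 survives, so Psi_1 is the Riemann
    component plus half of Ric(m, k). The latter is the first numerator term minus that same
    component, whence the average. *)
Lemma Psi1E : Psi1 A g nabla m p n k q =
  (g q (p q) (Rm m k m q) + g q (n q) (Rm m k k q)) / 2%:R.
Proof.
have two0 : (2%:R : R[i]) != 0 by rewrite pnatr_eq0.
have vmod := vf_module hM tangent_lin.
have ric : ricci A g nabla e (inord 0) (inord 3) q =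
    g q (p q) (Rm m k m q) - g q (m q) (Rm n k k q).
  rewrite /ricci gramE invmx_null_gram sum4 !sum4 !null_gramE //=.
  rewrite !mul0r !mul1r !addr0 !add0r.
  rewrite /riemann frame4_m frame4_p frame4_n frame4_k.
  have -> : g q (m q) (Rm p k m q) = 0.
    have := curvature_antisym vp vk vm vm => /eqP.
    by rewrite -addr_eq0 -mulr2n mulrn_eq0 /= => /eqP.
  have -> : g q (n q) (Rm k k m q) = 0.
    have := curvatureN hM oV vmod hn vk vk vm Vq => E.
    have t := tv (vcurv vk vk vm); have := metricNr hM tangent_lin hg Vq t (tv vn).
    by rewrite -E => /eqP; rewrite -addr_eq0 -mulr2n mulrn_eq0 /= => /eqP.
  by rewrite (curvature_antisym vn vk vk vm) add0r addr0.
(* Because k is repeated, this instance of pair symmetry follows from one Bianchi identity paired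
   with k: the term g(k, R(m, n) k) vanishes by antisymmetry. *)
have pair : g q (m q) (Rm n k k q) = g q (n q) (Rm m k k q).
  have bian := first_bianchi hM oV vmod hn vn vk vm Vq (lie_jacobi hM oV vn vk vm Vq).
  have [t1 t2 t3] := And3 (tv (vcurv vn vk vm)) (tv (vcurv vk vm vn)) (tv (vcurv vm vn vk)).
  have := congr1 (fun u => g q (k q) u) bian.
  rewrite /= (metricDr tangent_lin hg Vq (tangent_closedD tangent_lin Vq t1 t2) t3 (tv vk)).
  rewrite (metricDr tangent_lin hg Vq t1 t2 (tv vk)).
  rewrite (metricC hg (tv vk) (tangent0 hM q)) (metric0l hM hg (tv vk)).
  have -> : g q (k q) (Rm m n k q) = 0.
    have := curvature_antisym vm vn vk vk => /eqP.
    by rewrite -addr_eq0 -mulr2n mulrn_eq0 /= => /eqP.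
  rewrite (curvatureN hM oV vmod hn vk vm vn Vq).
  rewrite (metricNr hM tangent_lin hg Vq (tv (vcurv vm vk vn)) (tv vk)) addr0.
  rewrite (curvature_antisym vn vk vk vm) (curvature_antisym vm vk vk vn) opprK.
  by move/eqP; rewrite addrC subr_eq0 => /eqP.
rewrite /Psi1 /weyl gramE /idx_m /idx_k /idx_n !null_gramE //= ric.
rewrite /riemann frame4_m frame4_n frame4_k pair.
by rewrite !(mul0r, mulr0, mul1r, subr0, sub0r, addr0, add0r); field.
Qed.

End WeylScalars.

(** * Null frames adapted to N *)

Section AdaptedFrames.
Context {R : realType} {M : topologicalType} (A : set (chart R M)).
Hypothesis hM : smooth_manifold A.

Lemma span_fam_lin n (v : 'I_n -> tvec R M) (a : R[i]) u w :
  span_fam v u -> span_fam v w -> span_fam v (a *: u + w).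
Proof.
move=> [b _ <-] [c _ <-]; exists (a *: b + c) => //.
rewrite /lincomb scaler_sumr -big_split /=; apply: eq_bigr => i _.
by rewrite !mxE scalerDl scalerA.
Qed.

Lemma span_fam_mem n (v : 'I_n -> tvec R M) i : span_fam v (v i).
Proof.
exists (delta_mx 0 i) => //; rewrite /lincomb (bigD1 i) //= mxE !eqxx scale1r.
by rewrite big1 ?addr0 // => j ji; rewrite mxE eqxx (negPf ji) scale0r.
Qed.

Lemma section_module (E : M -> set (tvec R M)) (V : set M) : open V ->
  (forall p, V p -> forall (a : R[i]) u v,
    tangent A p u -> tangent A p v -> tangent A p (a *: u + v)) ->
  (forall p, V p -> forall (a : R[i]) u v, E p u -> E p v -> E p (a *: u + v)) ->
  (forall p, V p -> E p 0) -> field_module A V (section_on A E V).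
Proof.
move=> oV tl El E0; split.
- by move=> X [].
- move=> c X X' sc [vX EX] [vX' EX']; split; first exact: vf_lin.
  by move=> p Vp; apply: El => //; [exact: EX|exact: EX'].
- move=> X X' [vX EX] XX; split; first exact: vf_ext XX.
  by move=> p Vp; rewrite -XX //; exact: EX.
- by split; [exact: vf0|exact: E0].
Qed.

Lemma connection_restrict (U V : set M) D : open V -> V `<=` U ->
  (forall p, V p -> forall (a : R[i]) u v,
    tangent A p u -> tangent A p v -> tangent A p (a *: u + v)) ->
  connection A U D -> torsion_free A U D ->
  torsion_free_connection_on A V (vfield_on A V) D.
Proof.
move=> oV VU tl cD tD; have [cl ext linl addr leib] := cD V oV VU; split=> //.
- by move=> c X Y Y' sc vX vY vY' p Vp; rewrite addr ?leib //; exact: (modZ (vf_module hM tl)).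
- by move=> X Y vX vY p Vp; exact: (tD V X Y oV VU vX vY p Vp).
Qed.

Section ConnectionEq.
Variables (V : set M) (S : vfield R M -> Prop).
Variables (D W : vfield R M -> vfield R M -> vfield R M).
Hypotheses (oV : open V) (hS : field_module A V S).
Hypothesis hW : torsion_free_connection_on A V S W.
Hypothesis DW : forall X Y p, S X -> S Y -> V p -> D X Y p = W X Y p.

(** D is constrained only on sections of N. The clauses transfer from W since every argument they
    involve stays in S. *)
Lemma eq_connection_on : torsion_free_connection_on A V S D.
Proof.
have cl := conn_closed hW; have L := mod_lin hS; have Z := modZ hS.
split.
- move=> X Y SX SY; apply: (mod_ext hS (cl _ _ SX SY)) => p Vp; by rewrite DW.
- move=> X X' Y Y' SX SX' SY SY' XX YY p Vp; rewrite !DW //.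
  exact: (conn_ext hS hW).
- move=> c X X' Y sc SX SX' SY p Vp; rewrite !DW //; last exact: L.
  exact: (conn_linl hW).
- move=> c X Y Y' sc SX SY SY' p Vp; rewrite !DW //; last exact: L.
  exact: (conn_linr hW).
- move=> X Y SX SY p Vp; rewrite !DW //; exact/esym/(conn_torsion hW).
Qed.

(** The inner derivatives and the bracket remain in S, so D can be replaced by W in the outer
    derivatives as well. *)
Lemma eq_curvature X Y Z p : S X -> S Y -> S Z -> V p ->
  curvature A D X Y Z p = curvature A W X Y Z p.
Proof.
move=> SX SY SZ Vp; have cl := conn_closed eq_connection_on.
have E K L Q : S K -> S L -> S Q -> D K (D L Q) p = W K (W L Q) p.
  move=> SK SL SQ; rewrite DW //; last exact: cl.
  by apply: (conn_extr hS hW) => // [|r Vr]; [exact: cl|exact: DW].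
rewrite /curvature !E // DW //; exact: (lie_closed hM oV hS hW).
Qed.

End ConnectionEq.

Variable g : M -> tvec R M -> tvec R M -> R[i].
Hypothesis hg : complex_metric A g.

Section NullFrameExpansion.
Variables (V : set M) (m p n k : vfield R M).
Hypotheses (oV : open V) (hF : null_frame A g V m p n k).
Variable x : M.
Hypothesis Vx : V x.

Lemma null_frame_vf : [/\ vfield_on A V m, vfield_on A V p, vfield_on A V n &
  vfield_on A V k].
Proof.
have [[vF _] _] := hF.
split; [move: (vF (inord 0))|move: (vF (inord 1))|move: (vF (inord 2))|
  move: (vF (inord 3))];
  by rewrite ?frame4_m ?frame4_p ?frame4_n ?frame4_k.
Qed.

Lemma null_frame_gram (a b : nat) : (a < 4)%N -> (b < 4)%N ->
  g x (frame4 m p n k (inord a) x) (frame4 m p n k (inord b) x) =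
  ((a./2 == b./2) && (a != b))%:R.
Proof.
move=> a4 b4; have [_ /(_ x Vx) G] := hF.
by rewrite -null_gramE // -G mxE.
Qed.

(** Source of the hypothesis [tangent_lin]: where a frame exists, the tangent space is a single
    span. *)
Lemma null_frame_tangent_lin (a : R[i]) u v :
  tangent A x u -> tangent A x v -> tangent A x (a *: u + v).
Proof. by have [[_ /(_ x Vx)[_ ->]] _] := hF; exact: span_fam_lin. Qed.

Lemma null_frame_expand v : tangent A x v ->
  v = g x v (p x) *: m x + g x v (m x) *: p x + g x v (k x) *: n x
      + g x v (n x) *: k x.
Proof.
have [[_ /(_ x Vx)[_ tE]] _] := hF; have [vm vp vn vk] := null_frame_vf.
have [tm tp] := (vf_tangent vm Vx, vf_tangent vp Vx).
have [tn tk] := (vf_tangent vn Vx, vf_tangent vk Vx).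
(* The pointwise closure lemmas are used over the singleton of x, where closure is known and
   openness is not asked for. *)
have tl : forall y, [set x] y -> forall (a : R[i]) u v,
    tangent A y u -> tangent A y v -> tangent A y (a *: u + v).
  by move=> y -> a u w; exact: null_frame_tangent_lin.
have tZ := @tangent_closedZ _ _ A hM [set x] tl x erefl.
have tD := @tangent_closedD _ _ A [set x] tl x erefl.
rewrite {1}tE => -[a _ <-].
rewrite /lincomb sum4 /= frame4_m frame4_p frame4_n frame4_k.
have G := null_frame_gram.
have E (w : tvec R M) : tangent A x w ->
    g x (a 0 (inord 0) *: m x + a 0 (inord 1) *: p x + a 0 (inord 2) *: n x
       + a 0 (inord 3) *: k x) w =
    a 0 (inord 0) * g x (m x) w + a 0 (inord 1) * g x (p x) w
    + a 0 (inord 2) * g x (n x) w + a 0 (inord 3) * g x (k x) w.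
  by move=> tw; rewrite !(metricDl hg) ?(metricZl hM hg) //; auto.
rewrite !E //.
move: (G 0 0) (G 0 1) (G 0 2) (G 0 3) (G 1 0) (G 1 1) (G 1 2) (G 1 3)
  (G 2 0) (G 2 1) (G 2 2) (G 2 3) (G 3 0) (G 3 1) (G 3 2) (G 3 3).
rewrite frame4_m frame4_p frame4_n frame4_k /=.
do 16!(move=> -> //).
by rewrite !(mulr0, mulr1, addr0, add0r).
Qed.

Lemma null_frame_nondeg v : tangent A x v -> g x v (m x) = 0 ->
  g x v (p x) = 0 -> g x v (n x) = 0 -> g x v (k x) = 0 -> v = 0.
Proof.
move=> tv vm vp vn vk; rewrite (null_frame_expand tv) vm vp vn vk.
by rewrite !scale0r !addr0.
Qed.

End NullFrameExpansion.

Lemma null_frameS (U V : set M) m p n k : U `<=` V ->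
  null_frame A g V m p n k -> null_frame A g U m p n k.
Proof.
move=> UV [[vF fF] G]; split; last by move=> x /UV; exact: G.
by split=> [i|x /UV]; [exact: vfield_onS (vF i)|exact: fF].
Qed.

Lemma ord2 (i : 'I_2) : i = ord0 \/ i = lift ord0 ord0.
Proof. by case: i => [[|[|//]] ?]; [left|right]; exact: val_inj. Qed.

Section NormalizedFrame.
Variables (N : M -> set (tvec R M)) (V : set M) (m p n k : vfield R M).
Variables (f : 'I_2 -> vfield R M) (q : M).
Hypotheses (oV : open V) (hF : null_frame A g V m p n k) (Vq : V q).
Hypotheses (hf : local_frame A N V f)
  (Nq : N q = span_fam (tnth [tuple m q; k q])).

Let i0 : 'I_2 := ord0.
Let i1 : 'I_2 := lift ord0 ord0.

(** In a null frame p is dual to m, n is dual to k, and p, n span a null plane complementary to that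
    of m and k. *)
Definition dual_pair (i : 'I_2) : vfield R M := if i == ord0 then p else n.
Local Notation h := dual_pair.

Let vh i : vfield_on A V (h i).
Proof.
by have [_ vp vn _] := null_frame_vf hF; rewrite /h; case: ifP.
Qed.

Let vf i : vfield_on A V (f i) := hf.1 i.

Let G i j x := g x (f i x) (h j x).
Let det x := G i0 i0 x * G i1 i1 x - G i0 i1 x * G i1 i0 x.

Let sG i j : smooth_on A V (G i j).
Proof. exact: (metric_smooth oV hg). Qed.

Let sdet : smooth_on A V det.
Proof.
by apply: (smooth_onB hM oV); apply: (smooth_onM hM oV).
Qed.

Lemma metric_lincomb2 x (a : 'rV[R[i]]_2) (e : 'I_2 -> tvec R M) w :
  (forall i, tangent A x (e i)) -> tangent A x w -> V x ->
  g x (lincomb e a) w = a 0 i0 * g x (e i0) w + a 0 i1 * g x (e i1) w.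
Proof.
move=> te tw Vx; have tZ c u : tangent A x u -> tangent A x (c *: u).
  apply: (@tangent_closedZ _ _ A hM V _ x Vx) => y Vy; exact: (null_frame_tangent_lin hF Vy).
by rewrite lincomb2 (metricDl hg) ?(metricZl hM hg) //; exact: tZ.
Qed.

(** At q both m and k are combinations of f, and their products with (p, n) form the identity
    matrix; so 1 is the determinant of the coefficients times [det q]. *)
Lemma det_neq0 : det q != 0.
Proof.
have [vm vp vn vk] := null_frame_vf hF.
have [_ /(_ q Vq)[_ NqE]] := hf.
have tf i := vf_tangent (vf i) Vq; have th i := vf_tangent (vh i) Vq.
have GG := null_frame_gram hF Vq.
have Nm : N q (m q) by rewrite Nq; exact: (span_fam_mem (tnth [tuple m q; k q]) ord0).
have Nk : N q (k q) by rewrite Nq; exact: (span_fam_mem (tnth [tuple m q; k q]) i1).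
rewrite NqE in Nm Nk; have [a _ am] := Nm; have [b _ bk] := Nk.
have Em j : g q (m q) (h j q) = a 0 i0 * G i0 j q + a 0 i1 * G i1 j q.
  by rewrite -am metric_lincomb2.
have Ek j : g q (k q) (h j q) = b 0 i0 * G i0 j q + b 0 i1 * G i1 j q.
  by rewrite -bk metric_lincomb2.
move: (Em i0) (Em i1) (Ek i0) (Ek i1); rewrite /h /=.
move: (GG 0 1) (GG 0 2) (GG 3 1) (GG 3 2).
rewrite frame4_m frame4_p frame4_n frame4_k /= => -> // -> // -> // -> //.
rewrite ?mulr1n ?mulr0n => m0 m1 k0 k1; apply/eqP => d0.
suff : (1 : R[i]) = 0 by move/eqP; rewrite oner_eq0.
transitivity ((a 0 i0 * b 0 i1 - a 0 i1 * b 0 i0) * det q); last by rewrite d0 mulr0.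
transitivity ((1 * 1 - 0 * 0) : R[i]); first by ring.
by rewrite [X in X * _ - _]m0 [X in _ * X - _]k1 [X in _ - X * _]m1 [X in _ - _ * X]k0 /det; ring.
Qed.

(* The frame e is the inverse of the Gram matrix G applied to f; since the plane
   at q is spanned by m and k, duality forces e to be (m, k) at q. *)
Lemma normalized_frame : exists U (e : 'I_2 -> vfield R M),
  [/\ open U, U q, U `<=` V & local_frame A N U e] /\
  [/\ forall x i j, U x -> g x (e i x) (h j x) = (i == j)%:R,
      e i0 q = m q & e i1 q = k q].
Proof.
have [U [oU Uq UV det0]] := smooth_on_neq0 hM oV Vq sdet det_neq0.
pose c (i j : 'I_2) x := (det x)^-1 *
  (if i == i0 then if j == i0 then G i1 i1 x else - G i0 i1 x
   else if j == i0 then - G i1 i0 x else G i0 i0 x).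
pose e (i : 'I_2) x := lincomb (f ^~ x) (\row_j c i j x).
have eE i x : e i x = c i i0 x *: f i0 x + c i i1 x *: f i1 x.
  by rewrite [LHS]lincomb2 !mxE.
have sc i j : smooth_on A U (c i j).
  apply: (smooth_onM hM oU); first by apply: (smooth_onV hM oU) => //; exact: smooth_onS sdet.
  have sGU i' j' : smooth_on A U (G i' j') by exact: smooth_onS (sG i' j').
  case: (ord2 i) => ->; case: (ord2 j) => -> /=; do ?apply: (smooth_onN hM oU); exact: sGU.
have tl y : U y -> forall (a : R[i]) u v,
    tangent A y u -> tangent A y v -> tangent A y (a *: u + v).
  by move=> Uy; exact: (null_frame_tangent_lin hF (UV _ Uy)).
have ve i : vfield_on A U (e i).
  apply: (vf_ext hM (X := fun x => c i i0 x *: f i0 x + c i i1 x *: f i1 x)).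
    apply: (vf_lin hM tl (sc _ _)); first exact: vfield_onS (vf _).
    by apply: (modZ (vf_module hM tl) (sc _ _)); exact: vfield_onS (vf _).
  by move=> x _; rewrite eE.
have tf x i (Ux : U x) := vf_tangent (vf i) (UV _ Ux).
have th x i (Ux : U x) := vf_tangent (vh i) (UV _ Ux).
have dual x i j : U x -> g x (e i x) (h j x) = (i == j)%:R.
  move=> Ux; rewrite metric_lincomb2 //; [|by move=> l; exact: tf|exact: th|exact: UV].
  have d0 := det0 x Ux; rewrite !mxE -/(G _ _ _) -/(G _ _ _).
  by case: (ord2 i) => ->; case: (ord2 j) => ->; rewrite /c /= -/i0 -/i1;
    move: d0; rewrite /det => d0; field.
have lf : local_frame A N U e.
  split=> // x Ux; split.
    move=> a a0; apply/rowP => j; rewrite mxE.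
    have := metric_lincomb2 a (fun i => vf_tangent (ve i) Ux) (th x j Ux) (UV _ Ux).
    rewrite a0 (metric0l hM hg (th x j Ux)) !dual //.
    by case: (ord2 j) => -> /=; rewrite ?mulr0 ?mulr1 ?addr0 ?add0r.
  have [_ /(_ x (UV _ Ux))[_ ->]] := hf.
  apply/seteqP; split=> _ [a _ <-].
    have fE i : f i x = G i i0 x *: e i0 x + G i i1 x *: e i1 x.
      have d0 := det0 x Ux; rewrite /det in d0.
      apply: tvecP => y; rewrite !eE !tvecE.
      by case: (ord2 i) => ->; rewrite /c /= /det; field.
    rewrite lincomb2 !fE; exists (\row_j (a 0 i0 * G i0 j x + a 0 i1 * G i1 j x)) => //.
    by apply: tvecP => y; rewrite lincomb2 !mxE !tvecE; ring.
  rewrite lincomb2 !eE; exists (\row_j (a 0 i0 * c i0 j x + a 0 i1 * c i1 j x)) => //.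
  by apply: tvecP => y; rewrite lincomb2 !mxE !tvecE; ring.
have eq_q l i : N q l -> (forall j, g q l (h j q) = (i == j)%:R) -> e i q = l.
  have [_ /(_ q Uq)[_ NqE]] := lf; rewrite NqE => -[a _ <-] la.
  have aE j : a 0 j = (i == j)%:R.
    rewrite -la metric_lincomb2 //; [|by move=> l'; exact: vf_tangent (ve l') Uq|exact: th].
    by rewrite !dual //; case: (ord2 j) => -> /=; rewrite ?mulr0 ?mulr1 ?addr0 ?add0r.
  rewrite lincomb2 !aE.
  by case: (ord2 i) => -> /=; rewrite scale1r scale0r ?addr0 ?add0r.
have GG := null_frame_gram hF Vq.
exists U, e; split; split=> //; apply: eq_q.
- by rewrite Nq; exact: (span_fam_mem (tnth [tuple m q; k q]) ord0).
- move=> j; move: (GG 0 1) (GG 0 2); rewrite frame4_m frame4_p frame4_n.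
  by case: (ord2 j) => -> /= E1 E2; rewrite /h /= ?E1 ?E2.
- by rewrite Nq; exact: (span_fam_mem (tnth [tuple m q; k q]) i1).
- move=> j; move: (GG 3 1) (GG 3 2); rewrite frame4_k frame4_p frame4_n.
  by case: (ord2 j) => -> /= E1 E2; rewrite /h /= ?E1 ?E2.
Qed.

End NormalizedFrame.

End AdaptedFrames.

(** * Vanishing of Psi_0 and Psi_1 in a null frame adapted at a point *)

Lemma multiple_principal_of_null_frame (R : realType) (M : topologicalType)
  (A : set (chart R M)) (hM : smooth_manifold A)
  (g : M -> tvec R M -> tvec R M -> R[i]) (hg : complex_metric A g)
  (nabla : vfield R M -> vfield R M -> vfield R M)
  (hnabla : levi_civita A g nabla)
  (N : M -> set (tvec R M)) (hN : totally_null_field A g N)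
  (D : vfield R M -> vfield R M -> vfield R M)
  (hD : characteristic_connection A g N D)
  (hRic : antisym_cov2_ricci_vanishes A N D) (q : M) (V : set M)
  (m p n k : vfield R M) : open V -> V q -> null_frame A g V m p n k ->
  N q = span_fam (tnth [tuple m q; k q]) ->
  Psi0 A g nabla m p n k q = 0 /\ Psi1 A g nabla m p n k q = 0.
Proof.
move=> oV Vq hF Nq; have [/(_ q)[V1 [oV1 V1q [f0 lf0]]] hnull] := hN.
have [U1 [W [oU1 U1q [cW tW [B [[Blin Bs] hB]] WN] DW]]] := hD q.
pose V' := V `&` (V1 `&` U1).
have oV' : open V' by do 2?apply: openI.
have hF' : null_frame A g V' m p n k by apply: null_frameS hF => x [].
have lf' : local_frame A N V' f0.
  have [vf0 ff0] := lf0; split=> [i|x [_ [V1x _]]]; last exact: ff0.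
  by apply: vfield_onS (vf0 i) => x [_ []].
have V'q : V' q by split.
have [U [f [[oU Uq UV' lf] [dual fm fk]]]] :=
  normalized_frame hM hg oV' hF' V'q lf' Nq.
have UU1 : U `<=` U1 by move=> x /UV' [_ []].
have hFU := null_frameS UV' hF'.
have tl x : U x -> forall (a : R[i]) u v,
    tangent A x u -> tangent A x v -> tangent A x (a *: u + v).
  by move=> Ux; exact: (null_frame_tangent_lin hFU Ux).
have [vm vp vn vk] := null_frame_vf hFU.
pose S := section_on A N U.
have hS : field_module A U S.
  apply: (section_module hM oU tl) => x Ux; have [_ /(_ x Ux)[_ ->]] := lf.
    exact: span_fam_lin.
  by exists 0 => //; rewrite /lincomb big1 // => i _; rewrite mxE scale0r.
have [cN tN mN] := hnabla.
have hn : torsion_free_connection_on A U (vfield_on A U) nabla.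
  exact: (connection_restrict hM oU (@subsetT _ U) tl cN tN).
have hW : torsion_free_connection_on A U (vfield_on A U) W.
  exact: (connection_restrict hM oU UU1 tl cW tW).
(* Halving B puts compatibility in the form W g = - 2 b (x) g, for which the difference with the
   Levi-Civita connection has coefficients 1 and -1. *)
pose b X x := B x (X x) / 2%:R.
have two0 : (2%:R : R[i]) != 0 by rewrite pnatr_eq0.
have cn : weyl_compatible A U g nabla (fun _ _ => 0).
  split=> [X vX|X Y Z x vX vY vZ Ux]; first exact: (smooth_on_cst hM (0 : R[i]) oU).
  have := mN U X Y Z oU vX vY vZ x Ux; rewrite /nabla_metric => /eqP.
  by rewrite mul0r mulr0 subr0 -addrA -opprD subr_eq0 => /eqP.
have hcW : weyl_compatible A U g W b.
  split=> [X vX|X Y Z x vX vY vZ Ux].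
    by apply: (smooth_onM hM oU); [exact: Bs|exact: (smooth_on_cst hM _ oU)].
  have := hB U X Y Z oU UU1 vX vY vZ x Ux; rewrite /nabla_metric => /eqP.
  by rewrite -addrA -opprD subr_eq => /eqP ->; rewrite /b; field.
have b_lie : forall X Y x, vfield_on A U X -> vfield_on A U Y -> U x ->
    b (lie A X Y) x = b (W X Y) x - b (W Y X) x.
  move=> X Y x vX vY Ux; rewrite /b (conn_torsion hW vX vY Ux).
  have t K L : vfield_on A U K -> vfield_on A U L -> tangent A x (W K L x).
    by move=> vK vL; exact: vf_tangent (conn_closed hW vK vL) Ux.
  have -> : W X Y x - W Y X x = -1 *: W Y X x + W X Y x by rewrite scaleN1r addrC.
  by rewrite Blin; [field|exact: UU1|exact: t|exact: t].
have W_S Y X : vfield_on A U Y -> S X -> S (W Y X) by exact: WN.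
have S_null X Y x : S X -> S Y -> U x -> g x (X x) (Y x) = 0.
  move=> [_ NX] [_ NY] Ux; have [_ Nnull] := hnull x.
  by apply: Nnull; [exact: NX|exact: NY].
have Sf i : S (f i).
  split=> [|x Ux]; first by have [] := lf.
  by have [_ /(_ x Ux)[_ ->]] := lf; exact: (span_fam_mem (f ^~ x)).
have vh i : vfield_on A U (dual_pair p n i) by rewrite /dual_pair; case: ifP.
have GU x (Ux : U x) := null_frame_gram hFU Ux.
have h_null x i j : U x -> g x (dual_pair p n i x) (dual_pair p n j x) = 0.
  move=> /GU GG; move: (GG 1 1) (GG 1 2) (GG 2 1) (GG 2 2).
  rewrite frame4_p frame4_n /dual_pair /= => E1 E2 E3 E4.
  by case: ifP => _; case: ifP => _; rewrite ?E1 ?E2 ?E3 ?E4.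
(* Expanding f_i in the null frame, its coefficients on m and k are its products with p and n, that
   is 0 or 1 by duality. As u is orthogonal to p and n, orthogonality to f_0 and f_1 yields
   orthogonality to m and k. *)
have nondeg x u : U x -> tangent A x u -> (forall i, g x u (f i x) = 0) ->
    (forall i, g x u (dual_pair p n i x) = 0) -> u = 0.
  move=> Ux tu uf uh; have up := uh ord0; have un := uh (lift ord0 ord0).
  rewrite /dual_pair /= in up un.
  have tf i := vf_tangent (Sf i).1 Ux.
  have [tm tp] := (vf_tangent vm Ux, vf_tangent vp Ux).
  have [tn tk] := (vf_tangent vn Ux, vf_tangent vk Ux).
  have tZ := @tangent_closedZ _ _ A hM U tl x Ux; have tD := @tangent_closedD _ _ A U tl x Ux.
  have uE c1 c2 c3 c4 : g x u (c1 *: m x + c2 *: p x + c3 *: n x + c4 *: k x) =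
      c1 * g x u (m x) + c4 * g x u (k x).
    rewrite !(metricDr tl hg Ux) ?(metricZr hM tl hg Ux) //; auto.
    by rewrite up un !mulr0 !addr0.
  have ufE i : g x (f i x) (p x) * g x u (m x) + g x (f i x) (n x) * g x u (k x) = 0.
    by rewrite -[RHS](uf i) [in RHS](null_frame_expand hM hg hFU Ux (tf i)) uE.
  have := ufE ord0; have := ufE (lift ord0 ord0).
  have := dual x ord0 ord0 Ux; have := dual x ord0 (lift ord0 ord0) Ux.
  have := dual x (lift ord0 ord0) ord0 Ux.
  have := dual x (lift ord0 ord0) (lift ord0 ord0) Ux.
  rewrite /dual_pair /= => -> -> -> ->.
  rewrite !mul1r !mul0r addr0 add0r => uk um.
  exact: (null_frame_nondeg hM hg hFU Ux tu um up un uk).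
have span_f X x : S X -> U x -> exists a, X x = lincomb (f ^~ x) a.
  move=> [_ NX] Ux; have := NX x Ux; have [_ /(_ x Ux)[_ ->]] := lf.
  by case=> a _ <-; exists a.
have hWS := W_connection_on hS hW W_S.
have hDW X Y x : S X -> S Y -> U x -> D X Y x = W X Y x.
  by move=> SX SY Ux; exact: (DW U X Y oU UU1 SX SY x Ux).
have hDS := eq_connection_on hS hWS hDW.
(* The hypothesis concerns D, so the trace vanishes for D first; it is then read for W, which has
   the same curvature on sections of N. *)
have trD := trace_curvature_eq0 hM oU tl hg hS hDS Sf vh dual span_f Uq (hRic U f oU lf).
rewrite !(eq_curvature hM oU hS hWS hDW) // in trD.
have trN := trace_curvature_nabla hM oU tl hg hS hn hW cn hcW b_lie W_S S_null Sf
  vh dual nondeg Uq trD.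
have nullN := curvature_nabla_null hM oU tl hg hS hn hW cn hcW W_S S_null Sf vh nondeg.
have curvE := curvature_at hM oU tl hg hS hn S_null Sf vh dual h_null nondeg Uq.
have gE := hFU.2 q Uq; have vf i : vfield_on A U (f i) := (Sf i).1.
(* The fields m and k need not be sections of N away from q; only their values at q, equal to those
   of f, enter the curvature there. *)
have mkm : curvature A nabla m k m q =
    curvature A nabla (f ord0) (f (lift ord0 ord0)) (f ord0) q by exact: curvE.
have mkk : curvature A nabla m k k q =
    curvature A nabla (f ord0) (f (lift ord0 ord0)) (f (lift ord0 ord0)) q.
  exact: curvE.
have vcurv i := vf_tangent (curvature_closed hM oU (vf_module hM tl) hn (vf ord0)
  (vf (lift ord0 ord0)) (vf i)) Uq.
split; first by rewrite (Psi0E A nabla gE) mkk -fm nullN.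
rewrite (Psi1E hM oU tl hg hn cn vm vp vn vk Uq gE) mkm mkk.
rewrite (metricC hg (vf_tangent vp Uq) (vcurv _)) (metricC hg (vf_tangent vn Uq) (vcurv _)).
by move: trN; rewrite /dual_pair /= => ->; rewrite mul0r.
Qed.

Theorem theorem6p5 (R : realType) (M : topologicalType)
  (A : set (chart R M)) (hM : smooth_manifold A)
  (g : M -> tvec R M -> tvec R M -> R[i]) (hg : complex_metric A g)
  (nabla : vfield R M -> vfield R M -> vfield R M)
  (hnabla : levi_civita A g nabla)
  (N : M -> set (tvec R M)) (hN : totally_null_field A g N)
  (hint : integrable_field A N)
  (D : vfield R M -> vfield R M -> vfield R M)
  (hD : characteristic_connection A g N D)
  (hRic : antisym_cov2_ricci_vanishes A N D) :
  (forall q : M, algebraically_special A g nabla q) /\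
  multiple_principal_field A g nabla N.
Proof.
have mp : multiple_principal_field A g nabla N.
  move=> q; split; first exact: hN.2.
  move=> V m p n k oV Vq hF Nq.
  exact: (multiple_principal_of_null_frame hM hg hnabla hN hD hRic oV Vq hF Nq).
by split=> // q; exists (N q); exact: mp.
Qed.
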